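(* Let $(M^{2n-1},\xi)$ be a closed contact manifold and let $\eta$ be a Bourgeois contact structure on the trivial fiber bundle $M\times\mathbb T^2\to\mathbb T^2$ (with reference flat contact bundle $\xi\oplus T\mathbb T^2$), restricting to $\xi$ on each $M\times\{pt\}=M$. If $(M,\xi)$ is weakly filled by $(X^{2n},\omega)$, then $(M\times\mathbb T^2,\eta)$ is weakly filled by $(X\times\mathbb T^2,\omega+\omega_{\mathbb T^2})$, where $\omega_{\mathbb T^2}$ is some area form on $\mathbb T^2$.
   Context: Contact structures are cooriented and positive. A contact fiber bundle on a fiber bundle $\pi\colon V\to\Sigma$ over a closed oriented surface is a cooriented hyperplane field $\eta$ on $V$ inducing a contact structure $\xi_b=\eta\cap TM_b$ on each fiber $M_b=\pi^{-1}(b)$. Set $\xi_{fib}=\eta\cap\ker d\pi$. If $\eta=\ker\alpha$, the $d\alpha|_\eta$-orthogonal $\mathcal H$ of $\xi_{fib}$ in $\eta$ is an Ehresmann connection (contact connection) and $\eta=\xi_{fib}\oplus\mathcal H$. A flat contact bundle is a contact fiber bundle $\eta_0=\xi_{fib}\oplus\mathcal H_0$ with $\mathcal H_0$ flat (zero curvature). If $\eta=\xi_{fib}\oplus\mathcal H$ is another contact fiber bundle with the same $\xi_{fib}$, its potential $A$ with respect to $\eta_0$ is the $1$-form on $\Sigma$ with values in fiberwise contact vector fields given, for $u\in T_b\Sigma$, by $A_u=\widehat u-\widehat u^{\,0}$, where $\widehat u$, $\widehat u^{\,0}$ are the lifts of $u$ along $M_b$ that are horizontal for $\mathcal H$, $\mathcal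 H_0$ respectively. For a smooth family $\sigma$ of contact vector fields on the fibers (viewed as a vertical vector field $\overline\sigma$ on $V$) and a vector field $U$ on $\Sigma$ put $\nabla_U\sigma=[\widehat U^{0},\overline\sigma]$, and $d_\nabla A(U,W)=\nabla_U(A_W)-\nabla_W(A_U)-A_{[U,W]}$. A Bourgeois contact structure (on the flat contact bundle $(\pi,\eta_0)$) is a contact fiber bundle $\eta$ with the same $\xi_{fib}$ which is a contact structure on the total space $V$ and whose potential satisfies $d_\nabla A=0$ (equivalently, if $R_{\epsilon A}$ is the curvature of the contact connection with potential $\epsilon A$, $\frac1\epsilon R_{\epsilon A}\to0$ as $\epsilon\to0$). Here $\pi\colon M\times\mathbb T^2\to\mathbb T^2$ is the projection, $\eta_0=\xi\oplus T\mathbb T^2$, $\mathcal H_0=\{0\}\oplus T\mathbb T^2$. Weak filling: a compact symplectic manifold $(W^{2m+2},\Omega)$ with oriented boundary $\partial W=V^{2m+1}$ weakly fills $(V,\eta)$ if for one (hence every) contact form $\alpha$ of $\eta$, $\alpha\wedge(\Omega|_{TV}+\tau\,d\alpha)^m$ is a positive volume form on $V$ for all $\tau\ge0$. *)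

(* Defs.v *)
From HB Require Import structures.
From mathcomp Require Import all_boot all_order all_algebra all_fingroup.
From mathcomp Require Import all_classical all_reals all_analysis.

Set Implicit Arguments.
Unset Strict Implicit.
Unset Printing Implicit Defensive.
Import Order.TTheory GRing.Theory Num.Theory numFieldNormedType.Exports.
Local Open Scope classical_set_scope.
Local Open Scope ring_scope.

(* Smooth manifolds (possibly with boundary) are given by atlases. Tensor     *)
(* fields are families of coordinate expressions, one per chart, related by   *)
(* the usual transformation laws. In a chart of a d-manifold,                 *)
(*   - tangent vectors are row vectors u : 'rV_d,                             *)
(*   - covectors are columns a : 'cV_d, acting by u |-> u *m a,               *)
(*   - 2-covectors are skew matrices B : 'M_d, acting by                      *)
(*     (u, v) |-> u *m B *m v^T,                                              *)
(*   - a differential J, with rows the images of the coordinate vectors,      *)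
(*     acts by u |-> u *m J; covectors pull back by J *m a and J *m B *m J^T. *)

Section Calculus.
Variable R : realType.

(* The partial derivative is taken from the right, so that it also makes sense *)
(* along the boundary of the half-space x_0 >= 0; for a function with a smooth *)
(* local extension it is the partial derivative of the extension.              *)
Definition pd d (i : 'I_d) (f : 'rV[R]_d -> R) (x : 'rV[R]_d) : R :=
  lim ((fun h : R => h^-1 * (f (x + h *: delta_mx 0 i) - f x)) @ 0^'+).

Definition jac d k (F : 'rV[R]_d -> 'rV[R]_k) (x : 'rV[R]_d) : 'M[R]_(d, k) :=
  \matrix_(i, j) pd i (fun y => F y 0 j) x.

Definition smooth_open d (U : set 'rV[R]_d) (f : 'rV[R]_d -> R) : Prop :=
  forall (s : seq 'I_d) (x : 'rV[R]_d), U x ->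
    differentiable
      (foldr (fun i (g : 'rV[R]_d -> R) y => 'D_(delta_mx 0 i) g y) f s) x.

Definition smooth_on d (S : set 'rV[R]_d) (f : 'rV[R]_d -> R) : Prop :=
  forall x, S x -> exists (U : set 'rV[R]_d) (g : 'rV[R]_d -> R),
    [/\ open U, U x, smooth_open U g & forall y, U y -> S y -> g y = f y].

Definition smooth_mx_on d p q (S : set 'rV[R]_d) (F : 'rV[R]_d -> 'M[R]_(p, q))
  : Prop := forall i j, smooth_on S (fun x => F x i j).

Definition halfspace d : set 'rV[R]_d.+1 := [set x | 0 <= x 0 0].

Definition bracket d (X Y : 'rV[R]_d -> 'rV[R]_d) (x : 'rV[R]_d) : 'rV[R]_d :=
  X x *m jac Y x - Y x *m jac X x.

Definition ext_d1 d (a : 'rV[R]_d -> 'cV[R]_d) (x : 'rV[R]_d) : 'M[R]_d :=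
  \matrix_(i, j) (pd i (fun y => a y j 0) x - pd j (fun y => a y i 0) x).

Definition ext_d2_eq0 d (B : 'rV[R]_d -> 'M[R]_d) (x : 'rV[R]_d) : Prop :=
  forall i j l, pd i (fun y => B y j l) x + pd j (fun y => B y l i) x
                + pd l (fun y => B y i j) x = 0.

Definition pull2 d k (J : 'M[R]_(d, k)) (B : 'M[R]_k) : 'M[R]_d :=
  J *m B *m J^T.

(* For d.+1 = 2m: the value of B^m on the coordinate frame. *)
Definition pow_top d (B : 'M[R]_d.+1) : R :=
  (2 ^+ d.+1./2)^-1 *
  \sum_(s : 'S_d.+1) (-1) ^+ s *
    \prod_(k < d.+1./2) B (s (inord k.*2)) (s (inord k.*2.+1)).

(* For d.+1 = 2m+1: the value of a /\ B^m on the coordinate frame. *)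
Definition wedge_pow_top d (a : 'cV[R]_d.+1) (B : 'M[R]_d.+1) : R :=
  (2 ^+ d./2)^-1 *
  \sum_(s : 'S_d.+1) (-1) ^+ s * a (s ord0) 0 *
    \prod_(k < d./2) B (s (inord k.*2.+1)) (s (inord k.*2.+2)).

End Calculus.

(* The data of a family of charts of dimension d: the chart c maps [dom c]     *)
(* by [coord c] to R^d, with inverse [param c]. The axioms are in [manifold].  *)
Record premanifold (R : realType) (d : nat) := Premanifold {
  carrier :> topologicalType;
  chart : Type;
  dom : chart -> set carrier;
  coord : chart -> carrier -> 'rV[R]_d;
  param : chart -> 'rV[R]_d -> carrier
}.
Arguments chart {R d} M : rename.
Arguments dom {R d} M c : rename.
Arguments coord {R d} M c : rename.
Arguments param {R d} M c : rename.

Section Manifolds.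
Variable R : realType.

Definition cod d (M : premanifold R d) (c : chart M) : set 'rV[R]_d :=
  coord M c @` dom M c.
Definition overlap d (M : premanifold R d) (c c' : chart M) : set 'rV[R]_d :=
  coord M c @` (dom M c `&` dom M c').
Definition transition d (M : premanifold R d) (c c' : chart M) :
  'rV[R]_d -> 'rV[R]_d := coord M c' \o param M c.

(* Smooth manifolds modelled on H, where H is R^d or a half-space. *)
Definition manifold d (H : set 'rV[R]_d) (M : premanifold R d) : Prop :=
  [/\ hausdorff_space M, @second_countable M,
      (forall p : M, exists c, dom M c p),
      (forall c, [/\ open (dom M c),
                     exists2 O, open O & cod c = H `&` O,
                     (forall p, dom M c p -> param M c (coord M c p) = p),
                     {within dom M c, continuous (coord M c)} &
                     {within cod c, continuous (param M c)}]) &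
      (forall c c' : chart M, smooth_mx_on (overlap c c') (transition c c'))].

Definition oriented d (M : premanifold R d) : Prop :=
  forall (c c' : chart M) x, overlap c c' x ->
    0 < \det (jac (transition c c') x).

Definition closed_oriented_manifold d (M : premanifold R d) : Prop :=
  [/\ manifold [set: 'rV[R]_d] M, oriented M & compact [set: M]].

Definition compact_oriented_manifold_with_boundary d (W : premanifold R d.+1)
  : Prop := [/\ manifold (@halfspace R d) W, oriented W & compact [set: W]].

Definition bdry d (W : premanifold R d.+1) : set W :=
  [set p | exists c, dom W c p /\ coord W c p 0 0 = 0].
Arguments bdry {d} W.

Definition local_rep d k (M : premanifold R d) (N : premanifold R k)
  (f : M -> N) (c : chart M) (c' : chart N) : 'rV[R]_d -> 'rV[R]_k :=
  coord N c' \o f \o param M c.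

Definition local_dom d k (M : premanifold R d) (N : premanifold R k)
  (f : M -> N) (c : chart M) (c' : chart N) : set 'rV[R]_d :=
  coord M c @` (dom M c `&` f @^-1` dom N c').

(* i identifies V with the boundary of W as oriented manifolds, the boundary   *)
(* being oriented by the outward-normal-first rule (the outward normal is      *)
(* minus the 0-th coordinate vector). Positivity of the determinant implies    *)
(* that i is an immersion.                                                     *)
Definition oriented_boundary d (V : premanifold R d.+1)
  (W : premanifold R d.+2) (i : V -> W) : Prop :=
  [/\ continuous i, injective i, range i = bdry W &
      forall c c',
        smooth_mx_on (local_dom i c c') (local_rep i c c') /\
        forall x, local_dom i c c' x ->
          0 < \det (col_mx (- delta_mx 0 0 : 'rV[R]_d.+2)
                           (jac (local_rep i c c') x) : 'M[R]_d.+2)].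

Definition vfield d (M : premanifold R d) := chart M -> 'rV[R]_d -> 'rV[R]_d.
Definition form1 d (M : premanifold R d) := chart M -> 'rV[R]_d -> 'cV[R]_d.
Definition form2 d (M : premanifold R d) := chart M -> 'rV[R]_d -> 'M[R]_d.

Definition smooth_vfield d (M : premanifold R d) (X : vfield M) : Prop :=
  (forall c, smooth_mx_on (cod c) (X c)) /\
  (forall c c' x, overlap c c' x ->
     X c' (transition c c' x) = X c x *m jac (transition c c') x).

Definition smooth_form1 d (M : premanifold R d) (a : form1 M) : Prop :=
  (forall c, smooth_mx_on (cod c) (a c)) /\
  (forall c c' x, overlap c c' x ->
     a c x = jac (transition c c') x *m a c' (transition c c' x)).

Definition smooth_form2 d (M : premanifold R d) (w : form2 M) : Prop :=
  [/\ (forall c x, cod c x -> (w c x)^T = - w c x),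
      (forall c, smooth_mx_on (cod c) (w c)) &
      (forall c c' x, overlap c c' x ->
         w c x = pull2 (jac (transition c c') x) (w c' (transition c c' x)))].

Definition symplectic d (W : premanifold R d) (w : form2 W) : Prop :=
  smooth_form2 w /\
  forall c x, cod c x -> ext_d2_eq0 (w c) x /\ w c x \in unitmx.

(* The orientation of W is the one given by the top power of w. *)
Definition orients d (W : premanifold R d.+1) (w : form2 W) : Prop :=
  forall c x, cod c x -> 0 < pow_top (w c x).

Definition area_form (S : premanifold R 2) (w : form2 S) : Prop :=
  smooth_form2 w /\ forall c x, cod c x -> 0 < w c x 0 1.

(* A cooriented hyperplane in a vector space is encoded by its positive open   *)
(* half-space, i.e. the set of vectors u with a(u) > 0 when it is ker a,       *)
(* cooriented by a.                                                            *)
Definition hyperplane_field d (M : premanifold R d) :=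
  chart M -> 'rV[R]_d -> set 'rV[R]_d.

Definition defining_form d (M : premanifold R d) (xi : hyperplane_field M)
  (a : form1 M) : Prop :=
  [/\ smooth_form1 a, (forall c x, cod c x -> a c x != 0) &
      forall c x u, cod c x -> (xi c x u <-> 0 < (u *m a c x) 0 0)].

Definition contact_form d (M : premanifold R d.+1) (xi : hyperplane_field M)
  (a : form1 M) : Prop :=
  [/\ ~~ odd d, defining_form xi a &
      forall c x, cod c x -> 0 < wedge_pow_top (a c x) (ext_d1 (a c) x)].

Definition contact_structure d (M : premanifold R d.+1)
  (xi : hyperplane_field M) : Prop := exists a, contact_form xi a.

(* (W, w) weakly fills (V, eta), the boundary of W being identified with V     *)
(* through i.                                                                  *)
Definition weakly_fills d (W : premanifold R d.+2) (w : form2 W)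
  (V : premanifold R d.+1) (eta : hyperplane_field V) (i : V -> W) : Prop :=
  [/\ compact_oriented_manifold_with_boundary W,
      symplectic w, orients w, oriented_boundary i &
      exists2 a, contact_form eta a &
        forall (tau : R) c c' x, 0 <= tau -> local_dom i c c' x ->
          0 < wedge_pow_top (a c x)
                (pull2 (jac (local_rep i c c') x) (w c' (local_rep i c c' x))
                 + tau *: ext_d1 (a c) x)].

Definition product d k (M : premanifold R d) (N : premanifold R k) :
  premanifold R (d + k) :=
  @Premanifold R (d + k) (M * N)%type (chart M * chart N)%type
    (fun c => dom M c.1 `*` dom N c.2)
    (fun c p => row_mx (coord M c.1 p.1) (coord N c.2 p.2))
    (fun c y => (param M c.1 (lsubmx y), param N c.2 (rsubmx y))).

Definition sum_form2 d k (M : premanifold R d) (N : premanifold R k)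
  (w : form2 M) (s : form2 N) : form2 (product M N) :=
  fun c y => block_mx (w c.1 (lsubmx y)) 0 0 (s c.2 (rsubmx y)).

Definition prod_id d d' k (V : premanifold R d) (W : premanifold R d')
  (N : premanifold R k) (i : V -> W) : product V N -> product W N :=
  fun p => (i p.1, p.2).

End Manifolds.

(* Contact connections on the trivial bundle M x S -> S. The reference flat    *)
(* contact bundle is xi (+) TS, whose horizontal lifts are u |-> (0, u).       *)
Section ContactBundles.
Variables (R : realType) (d k : nat).
Variables (M : premanifold R d.+1) (S : premanifold R k).
Implicit Types (a : form1 (product M S)) (U W : vfield S).

(* v lies in the orthogonal of ker a /\ TM for d a, inside ker a. *)
Definition horizontal a (c : chart (product M S)) (y v : 'rV[R]_(d.+1 + k))
  : Prop :=
  v *m a c y = 0 /\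
  forall z : 'rV[R]_(d.+1 + k), rsubmx z = 0 -> z *m a c y = 0 ->
    v *m ext_d1 (a c) y *m z^T = 0.

Definition hlift a (c : chart (product M S)) (y : 'rV[R]_(d.+1 + k))
  (u : 'rV[R]_k) : 'rV[R]_(d.+1 + k) :=
  xget 0 [set v | horizontal a c y v /\ rsubmx v = u].

Definition hlift0 (u : 'rV[R]_k) : 'rV[R]_(d.+1 + k) := row_mx 0 u.

(* The vertical vector field A_U of the potential A, in a product chart. *)
Definition potential a U (c : chart (product M S)) (y : 'rV[R]_(d.+1 + k))
  : 'rV[R]_(d.+1 + k) :=
  hlift a c y (U c.2 (rsubmx y)) - hlift0 (U c.2 (rsubmx y)).

Definition nabla U (c : chart (product M S))
  (sigma : 'rV[R]_(d.+1 + k) -> 'rV[R]_(d.+1 + k))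
  : 'rV[R]_(d.+1 + k) -> 'rV[R]_(d.+1 + k) :=
  bracket (fun y => hlift0 (U c.2 (rsubmx y))) sigma.

Definition d_nabla_potential a U W (c : chart (product M S))
  (y : 'rV[R]_(d.+1 + k)) : 'rV[R]_(d.+1 + k) :=
  nabla U c (potential a W c) y - nabla W c (potential a U c) y
  - potential a (fun e => bracket (U e) (W e)) c y.

Definition restricts_to_fibers (xi : hyperplane_field M)
  (eta : hyperplane_field (product M S)) : Prop :=
  forall (c : chart (product M S)) y (u : 'rV[R]_d.+1), cod c y ->
    (eta c y (row_mx u 0) <-> xi c.1 (lsubmx y) u).

(* The connection of a contact form of eta depends on eta only. *)
Definition bourgeois (xi : hyperplane_field M)
  (eta : hyperplane_field (product M S)) : Prop :=
  restricts_to_fibers xi eta /\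
  exists2 a, @contact_form R (d + k) (product M S) eta a &
    forall U W, smooth_vfield U -> smooth_vfield W ->
      forall c y, cod c y -> d_nabla_potential a U W c y = 0.

End ContactBundles.

Section Torus.
Variable R : realType.

Definition lattice_rel : rel 'rV[R]_2 :=
  fun x y => [forall i, x 0 i - y 0 i \is a Num.int].

Lemma lattice_rel_refl : reflexive lattice_rel.
Proof. by move=> x; apply/forallP => i; rewrite subrr rpred0. Qed.

Lemma lattice_rel_sym : symmetric lattice_rel.
Proof.
by move=> x y; apply: eq_forallb => i; rewrite -opprB rpredN.
Qed.

Lemma lattice_rel_trans : transitive lattice_rel.
Proof.
move=> y x z /forallP xy /forallP yz; apply/forallP => i.
by rewrite -(subrKA (y 0 i)) rpredD.
Qed.

Canonical lattice_equiv :=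
  EquivRel lattice_rel lattice_rel_refl lattice_rel_sym lattice_rel_trans.

Definition torus_space := quotient_topology {eq_quot lattice_equiv}%qT.
HB.instance Definition _ := Topological.on torus_space.
HB.instance Definition _ := Quotient.on torus_space.

Definition torus_box (b : 'rV[R]_2) : set 'rV[R]_2 :=
  [set x | forall i, `|x 0 i - b 0 i| < 2^-1].

(* R^2 / Z^2, with one chart for each open unit square. *)
Definition torus : premanifold R 2 :=
  @Premanifold R 2 torus_space 'rV[R]_2
    (fun b => (fun x => \pi_torus_space%qT x) @` torus_box b)
    (fun b p => xget 0 [set x | torus_box b x /\ \pi_torus_space%qT x = p])
    (fun b x => \pi_torus_space%qT x).

End Torus.

(* Main.v *)
Require Import Defs.
From mathcomp Require Import all_boot all_order all_algebra all_fingroup.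
From mathcomp Require Import all_classical all_reals all_analysis.
From mathcomp Require Import ring lra zify.
Import Defs.

(** Let a be a contact form of eta, let a0 be a contact form of xi for which
    omega satisfies the filling condition, and let the area form on the torus
    be s dx /\ dy with a constant s > 0 to be chosen. Write 2m + 1 for the
    dimension of M x T^2 and omega also for the pullback of omega to M x T^2.
    As dx /\ dy squares to zero,
      a /\ (omega + s dx /\ dy + tau da)^m =
        a /\ (omega + tau da)^m
        + m s (a_M /\ (omega + tau da_M)^(m - 1)) /\ dx /\ dy,
    where a_M is the restriction of a to the fibers M (wedge_pow_top_area). The
    coefficient of s is positive: eta restricts to xi, hence a_M = f a0 with
    f > 0, and da_M differs from f da0 by df /\ a0, which a_M kills. So it is
    a multiple of the filling condition of (X, omega) at the parameter f tau
    (ext_d1_scale, wedge_pow_top_scale_pos, fiber_pos).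

    It remains to find one s that works at all points and for all tau >= 0. Put
    lam = 1 / (1 + tau). Up to the factor lam^m the value above becomes that of
    a /\ (lam (omega + s dx /\ dy) + (1 - lam) da)^m, which has the form
    P + lam s m Q with P and Q continuous in the point and in lam, for lam in
    the closed interval [0, 1]. Here Q > 0 everywhere, and at lam = 0 also
    P > 0, since eta is contact. Near a point with lam = 0 the term P suffices,
    near any other point lam Q is bounded below, and compactness of
    M x T^2 x [0, 1] yields a common s (dominated_pos, filling_pos_uniform).

    The values are computed in charts, so their sign must not depend on the
    charts (filling_value_chart_change). For da this rests on the symmetry of
    second derivatives (mixed_derive_sym, ext_d1_pullback). For omega it rests
    on a chain rule for partial derivatives taken along positive rays (pd_comp),
    because the boundary of X maps to the boundary of the half-space in charts.

    Finally X x T^2 has to be a compact symplectic manifold with oriented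
    boundary M x T^2. This combines torus_manifold, product_manifold,
    sum_form2_symplectic, sum_form2_orients and prod_id_oriented_boundary. *)

Set Implicit Arguments.
Unset Strict Implicit.
Unset Printing Implicit Defensive.

(** * Alternating sums over permutations *)

Section AlternatingSums.
Import Order.TTheory GRing.Theory Num.Theory.
Local Open Scope ring_scope.

(** Writing Psi as a combination of indicator functions turns both sides into
    combinations of determinants; those on the left are block triangular with
    an identity block for the last k indices. *)
Lemma alt_sum_fix (K : comNzRingType) (n k : nat)
  (Psi : {ffun 'I_n -> 'I_(n + k)} -> K) :
  \sum_(s : 'S_(n + k)) (-1) ^+ s *
     (\prod_(j < k) (s (rshift n j) == rshift n j)%:R * Psi [ffun i => s (lshift k i)])
  = \sum_(s : 'S_n) (-1) ^+ s * Psi [ffun i => lshift k (s i)].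
Proof.
have PsiE f : Psi f = \sum_(g : {ffun 'I_n -> 'I_(n + k)})
    Psi g * \prod_i (f i == g i)%:R.
  rewrite (bigD1 f) //= big1 ?mulr1; last by move=> i _; rewrite eqxx.
  rewrite big1 ?addr0 // => g ngf.
  have [i nfg] : exists i, f i != g i.
    apply/existsP; apply: contraR ngf; rewrite negb_exists => /forallP fg.
    by apply/eqP/ffunP => i; apply/esym/eqP; rewrite -[_ == _]negbK.
  by rewrite (bigD1 i) //= (negPf nfg) mul0r mulr0.
transitivity (\sum_(g : {ffun 'I_n -> 'I_(n + k)}) Psi g *
    \det (col_mx (\matrix_(i < n, j < n + k) (j == g i)%:R)
                 (row_mx 0 1%:M) : 'M[K]_(n + k))).
  under eq_bigr => s _ do rewrite PsiE mulr_sumr mulr_sumr.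
  rewrite exchange_big /=; apply: eq_bigr => g _.
  rewrite /determinant mulr_sumr; apply: eq_bigr => s _.
  rewrite !mulrA (mulrC (Psi g)) -!mulrA; congr (_ * _).
  rewrite mulrCA; congr (_ * _); rewrite mulrC big_split_ord /=.
  congr (_ * _); apply: eq_bigr => i _.
    by rewrite col_mxEu mxE ffunE.
  rewrite col_mxEd; case: (split_ordP (s (rshift n i))) => j ->.
    by rewrite row_mxEl mxE eq_lrshift.
  by rewrite row_mxEr mxE eq_rshift eq_sym.
under [RHS]eq_bigr => s _ do rewrite PsiE mulr_sumr.
rewrite exchange_big /=; apply: eq_bigr => g _.
rewrite -[\matrix_(i, j) _]hsubmxK -/(block_mx _ _ _ _) det_ublock det1 mulr1.
rewrite /determinant mulr_sumr; apply: eq_bigr => s _.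
rewrite mulrCA; congr (_ * (_ * _)); apply: eq_bigr => i _.
by rewrite !mxE ffunE.
Qed.

(** At most one of the e k is nonzero. *)
Lemma prod_add_orth (K : idomainType) (m : nat) (x e : 'I_m -> K) :
  (forall k l, k != l -> e k * e l = 0) ->
  \prod_k (x k + e k) = \prod_k x k + \sum_k e k * \prod_(l | l != k) x l.
Proof.
move=> e0; case: (pickP (fun k => e k != 0)) => [k ek|ez]; last first.
  rewrite [X in _ + X]big1 => [|k _].
    by rewrite addr0; apply: eq_bigr => k _; move/negbFE/eqP: (ez k) => ->; rewrite addr0.
  by move/negbFE/eqP: (ez k) => ->; rewrite mul0r.
have el l : l != k -> e l = 0.
  by move=> lk; have /eqP := e0 _ _ lk; rewrite mulf_eq0 (negPf ek) orbF => /eqP.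
rewrite (bigD1 k) //= [X in _ = X + _](bigD1 k) //=.
rewrite [X in _ = _ + X](bigD1 k) //= [X in _ + (_ + X)]big1; last first.
  by move=> l /el ->; rewrite mul0r.
rewrite addr0 -mulrDl; congr (_ * _); apply: eq_bigr => l /el ->.
by rewrite addr0.
Qed.

(** The matrix of the standard area form of the plane. *)
Definition area_mx (K : comNzRingType) : 'M[K]_2 := delta_mx 0 1 - delta_mx 1 0.

(** The area form is nonzero only on the last two indices, and a permutation
    hits both of them in at most one of the pairs (U k, V k). Exchanging two
    pairs is an even permutation, so all m + 1 pairs contribute alike, and the
    two orders within the pair give the factor 2. The indices zs carry the
    factors of degree one: a single index for a /\ B^m, none for B^m. *)
Lemma alt_sum_area (K : idomainType) (n m : nat) (zs : seq 'I_n)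
  (u v : 'I_m -> 'I_n) (U V : 'I_m.+1 -> 'I_(n + 2))
  (a : 'I_(n + 2) -> K) (B : 'M[K]_(n + 2)) (t : K) :
  injective U -> injective V -> (forall k l, U k != V l) ->
  (forall k z, z \in zs -> (U k != lshift 2 z) && (V k != lshift 2 z)) ->
  (forall k, U (widen_ord (leqnSn m) k) = lshift 2 (u k)) ->
  (forall k, V (widen_ord (leqnSn m) k) = lshift 2 (v k)) ->
  U ord_max = rshift n 0 -> V ord_max = rshift n 1 ->
  \sum_(s : 'S_(n + 2)) (-1) ^+ s * (\prod_(z <- zs) a (s (lshift 2 z))) *
    \prod_(k < m.+1) (B + block_mx 0 0 0 (t *: area_mx K)) (s (U k)) (s (V k))
  = \sum_(s : 'S_(n + 2)) (-1) ^+ s * (\prod_(z <- zs) a (s (lshift 2 z))) *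
      \prod_(k < m.+1) B (s (U k)) (s (V k))
    + t * (m.+1.*2)%:R * \sum_(s : 'S_n) (-1) ^+ s * (\prod_(z <- zs) a (lshift 2 (s z))) *
      \prod_(k < m) B (lshift 2 (s (u k))) (lshift 2 (s (v k))).
Proof.
move=> Uinj Vinj UV zsP uE vE Up Vq.
pose p := rshift n (0 : 'I_2); pose q := rshift n (1 : 'I_2).
have pq : p != q by rewrite eq_rshift.
set E := block_mx _ _ _ _.
have EE i j : E i j = t * (((i == p) && (j == q))%:R - ((i == q) && (j == p))%:R).
  rewrite /E; case: (split_ordP i) => i' ->; case: (split_ordP j) => j' ->;
    rewrite ?block_mxEul ?block_mxEur ?block_mxEdl ?block_mxEdr !mxE
      ?eq_lrshift ?eq_rlshift ?andbF ?subrr ?mulr0 //=.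
  by rewrite !eq_rshift.
pose A (s : 'S_(n + 2)) := \prod_(z <- zs) a (s (lshift 2 z)).
pose G k (s : 'S_(n + 2)) := \prod_(l | l != k) B (s (U l)) (s (V l)).
have expand (s : 'S_(n + 2)) : \prod_k (B + E) (s (U k)) (s (V k)) =
    \prod_k B (s (U k)) (s (V k)) + \sum_k E (s (U k)) (s (V k)) * G k s.
  under eq_bigr => k _ do rewrite mxE.
  apply: prod_add_orth.
  move=> k l kl; rewrite !EE.
  have hit x y (kx : x = U k \/ x = V k) (ly : y = U l \/ y = V l) r :
      (s x == r) && (s y == r) = false.
    apply/negP => /andP[/eqP <-] /eqP/perm_inj.
    case: kx ly => -> [] -> /eqP; rewrite ?(inj_eq Uinj) ?(inj_eq Vinj).
    - by rewrite eq_sym (negPf kl).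
    - by rewrite eq_sym (negPf (UV _ _)).
    - by rewrite (negPf (UV _ _)).
    - by rewrite eq_sym (negPf kl).
  rewrite mulrACA; apply/eqP; rewrite mulf_eq0; apply/orP; right.
  rewrite mulrBl !mulrBr -!natrM !mulnb.
  have h x y r b c : x = U k \/ x = V k -> y = U l \/ y = V l ->
      [&& (s x == r) && b & (s y == r) && c] = false.
    move=> kx ly; have := hit x y kx ly r; case: (s x == r) => //=.
    by case: (s y == r) => //= _; rewrite andbF.
  have h' x y r b c : x = U k \/ x = V k -> y = U l \/ y = V l ->
      [&& (s x == r) && b & c && (s y == r)] = false.
    by move=> kx ly; rewrite (andbC c) h.
  rewrite !h ?h' ?[(s (U k) == q) && _]andbC ?h' ?h ?[(s (U k) == p) && _]andbC ?h ?h'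
    ?subrr //; by [left|right].
under eq_bigr => s _ do rewrite expand mulrDr.
rewrite big_split /=; congr (_ + _).
have -> : \sum_(s : 'S_(n + 2)) (-1) ^+ s * A s *
    \sum_k E (s (U k)) (s (V k)) * G k s =
  \sum_k \sum_(s : 'S_(n + 2)) (-1) ^+ s * A s * (E (s (U k)) (s (V k)) * G k s).
  by rewrite exchange_big; apply: eq_bigr => s _; rewrite mulr_sumr.
pose T k (s : 'S_(n + 2)) := (-1) ^+ s * A s * (E (s (U k)) (s (V k)) * G k s).
have sameT k : \sum_s T k s = \sum_s T ord_max s.
  have [->//|kN] := eqVneq k ord_max.
  (* The even permutation exchanging the k-th and the last pair. *)
  pose r : 'S_(n + 2) := (tperm (U k) (U ord_max) * tperm (V k) (V ord_max))%g.
  rewrite (reindex_inj (mulgI r)) /=; apply: eq_bigr => s _.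
  have rs x : (r * s)%g x = s (r x) by exact: permM.
  have rU l : r (U l) = U (tperm k ord_max l).
    rewrite permM -(inj_tperm _ _ _ Uinj).
    by apply: tpermD; rewrite eq_sym UV.
  have rV l : r (V l) = V (tperm k ord_max l).
    have Vl : tperm (U k) (U ord_max) (V l) = V l by apply: tpermD; rewrite UV.
    by rewrite permM Vl -(inj_tperm _ _ _ Vinj).
  rewrite /T odd_permM odd_permM !odd_tperm (inj_eq Uinj) (inj_eq Vinj) kN /=.
  congr (_ * _ * (_ * _)).
  - rewrite /A; apply: eq_big_seq => z zz; rewrite rs permM.
    have [/andP[Uk Vk] /andP[Um Vm]] := (zsP k z zz, zsP ord_max z zz).
    by rewrite (tpermD Uk Um) (tpermD Vk Vm).
  - by rewrite !rs rU rV !tpermL.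
  - rewrite /G (reindex_inj (@perm_inj _ (tperm k ord_max))) /=.
    apply: eq_big => [l|l _].
      by rewrite -{2}(tpermR k ord_max) (inj_eq perm_inj).
    by rewrite !rs rU rV !tpermK.
have -> : \sum_k \sum_s T k s = \sum_(k < m.+1) \sum_s T ord_max s.
  by apply: eq_bigr => k _; rewrite sameT.
rewrite sumr_const card_ord.
pose Psi (f : {ffun 'I_n -> 'I_(n + 2)}) :=
  \prod_(z <- zs) a (f z) * \prod_(k < m) B (f (u k)) (f (v k)).
pose Y (s : 'S_(n + 2)) := (-1) ^+ s *
  (\prod_(j < 2) (s (rshift n j) == rshift n j)%:R * Psi [ffun i => s (lshift 2 i)]).
have AG s : A s * G ord_max s = Psi [ffun i => s (lshift 2 i)].
  rewrite /Psi /A /G; congr (_ * _); first by apply: eq_bigr => z _; rewrite ffunE.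
  rewrite big_mkcond big_ord_recr /= eqxx mulr1; apply: eq_bigr => k _.
  rewrite !ffunE uE vE ifT //; apply/eqP => /(congr1 val) /= km.
  by have := ltn_ord k; rewrite km ltnn.
have YE s : Y s = (-1) ^+ s * A s * (((s p == p) && (s q == q))%:R * G ord_max s).
  rewrite /Y -AG !big_ord_recr big_ord0 /= mul1r.
  rewrite (_ : widen_ord _ ord_max = 0); last exact: val_inj.
  rewrite (_ : ord_max = 1); last exact: val_inj.
  rewrite -/p -/q -natrM mulnb.
  by move: (_ && _)%:R (A s) (G _ s) ((-1) ^+ s) => x y z e; ring.
have TE : \sum_s T ord_max s = t * 2%:R * \sum_s Y s.
  transitivity (t * \sum_s (Y s + Y (tperm p q * s)%g)).
    rewrite mulr_sumr; apply: eq_bigr => s _.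
    rewrite !YE /T EE Up Vq -/p -/q odd_permM odd_tperm pq /= !permM tpermL tpermR.
    have -> : A (tperm p q * s)%g = A s.
      rewrite /A; apply: eq_big_seq => z zz; rewrite permM.
      have /andP[Um Vm] := zsP ord_max z zz.
      by rewrite Up in Um; rewrite Vq in Vm; rewrite tpermD.
    have -> : G ord_max (tperm p q * s)%g = G ord_max s.
      apply: eq_bigr => l lm.
      have [Upl Uql] : p != U l /\ q != U l.
        by rewrite /p /q -Up -Vq (inj_eq Uinj) eq_sym lm eq_sym UV.
      have [Vpl Vql] : p != V l /\ q != V l.
        by rewrite /p /q -Up -Vq (inj_eq Vinj) UV eq_sym lm.
      by rewrite !permM !tpermD.
    rewrite signrN [(s q == p) && _]andbC.
    move: (_ && _)%:R (_ && _)%:R (A s) (G _ s) ((-1) ^+ s) => x y b c e; ring.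
  have -> : \sum_s (Y s + Y (tperm p q * s)%g) = \sum_s Y s + \sum_s Y s.
    rewrite big_split /=; congr (_ + _).
    by rewrite [RHS](reindex_inj (mulgI (tperm p q))).
  by rewrite -mulr2n -[_ *+ 2]mulr_natl mulrA.
rewrite TE /Y alt_sum_fix -(mulr_natr _ m.+1) -muln2 natrM.
suff -> : \sum_(s : 'S_n) (-1) ^+ s * (\prod_(z <- zs) a (lshift 2 (s z))) *
      \prod_(k < m) B (lshift 2 (s (u k))) (lshift 2 (s (v k))) =
    \sum_(s : 'S_n) (-1) ^+ s * Psi [ffun i => lshift 2 (s i)].
  by move: (\sum_s _) (m.+1%:R) => S M; ring.
apply: eq_bigr => s _; rewrite /Psi -mulrA; congr (_ * (_ * _)).
  by apply: eq_bigr => z _; rewrite ffunE.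
by apply: eq_bigr => k _; rewrite !ffunE.
Qed.

End AlternatingSums.

(** * Top-degree values of forms on a coordinate frame *)

Section TopForms.
Import Order.TTheory GRing.Theory Num.Theory.
Local Open Scope ring_scope.

Lemma big_odd_pairs (K : comNzRingType) (d : nat) (F : 'I_d.+1 -> K) :
  ~~ odd d ->
  \prod_i F i = F ord0 * \prod_(k < d./2) (F (inord k.*2.+1) * F (inord k.*2.+2)).
Proof.
move=> de.
have pairs (G : nat -> K) m : \prod_(i < m.*2) G i.+1 =
    \prod_(k < m) (G k.*2.+1 * G k.*2.+2).
  elim: m => [|m IH]; first by rewrite !big_ord0.
  by rewrite doubleS !big_ord_recr /= IH mulrA.
rewrite big_ord_recl; congr (_ * _).
rewrite -(pairs (fun i => F (inord i)) d./2).
rewrite (even_halfK de); apply: eq_bigr => i _; congr F.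
by apply: val_inj; rewrite /= inordK // ltnS.
Qed.

Section Wedge.
Variable R : realType.

(** The matrix with rows a, u (h 0), v (h 0), u (h 1), v (h 1) and so on. The
    index of the pair is recovered from the row number by a partial inverse, so
    that d./2 = 0 needs no separate treatment. *)
Definition rows_mx (d : nat) (I : Type) (a : 'cV[R]_d.+1)
  (u v : I -> 'cV[R]_d.+1) (h : 'I_(d./2) -> I) : 'M[R]_d.+1 :=
  \matrix_(i, j) if i == 0 :> nat then a j 0 else
    oapp (fun k => (if odd i then u else v) (h k) j 0) 0 (insub (i.-1)./2).

Lemma pair_lt (d : nat) (k : 'I_(d./2)) : (k.*2.+2 < d.+1)%N.
Proof. have := ltn_ord k; have := odd_double_half d; lia. Qed.

Lemma rows_mx_odd d I a u v h (k : 'I_(d./2)) j :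
  @rows_mx d I a u v h (inord k.*2.+1) j = u (h k) j 0.
Proof.
have kd := ltnW (pair_lt k).
rewrite mxE inordK //= odd_double /=.
by have -> : insub (k.*2)./2 = Some k by rewrite doubleK valK.
Qed.

Lemma rows_mx_even d I a u v h (k : 'I_(d./2)) j :
  @rows_mx d I a u v h (inord k.*2.+2) j = v (h k) j 0.
Proof.
have kd := pair_lt k.
rewrite mxE inordK //= odd_double /=.
by have -> : insub (uphalf k.*2) = Some k by rewrite uphalf_double valK.
Qed.

(** Multilinear expansion of a /\ B^m along a decomposition of B into rank one
    matrices. It reduces the behaviour of a /\ B^m under linear maps and shears
    to properties of determinants. *)
Lemma wedge_pow_top_det (d : nat) (I : finType) (u v : I -> 'cV[R]_d.+1)
  (a : 'cV[R]_d.+1) (B : 'M[R]_d.+1) :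
  ~~ odd d -> B = \sum_r u r *m (v r)^T ->
  wedge_pow_top a B =
  (2 ^+ d./2)^-1 * \sum_(h : {ffun 'I_(d./2) -> I}) \det (rows_mx a u v h).
Proof.
move=> de BE; have Bij i j : B i j = \sum_r u r i 0 * v r j 0.
  rewrite BE summxE; apply: eq_bigr => r _.
  by rewrite mxE big_ord1 [_^T _ _]mxE.
rewrite /wedge_pow_top; congr (_ * _).
rewrite exchange_big /=; apply: eq_bigr => s _.
under [X in _ * X]eq_bigr => k _ do rewrite Bij.
rewrite bigA_distr_bigA mulr_sumr; apply: eq_bigr => h _.
rewrite -mulrA; congr (_ * _); rewrite big_odd_pairs // mxE /=.
by congr (_ * _); apply: eq_bigr => k _; rewrite rows_mx_odd rows_mx_even.
Qed.

Lemma rows_mx_mul d (I : Type) (J : 'M[R]_d.+1) a u v (h : 'I_(d./2) -> I) :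
  rows_mx (J *m a) (fun r => J *m u r) (fun r => J *m v r) h =
  rows_mx a u v h *m J^T.
Proof.
apply/matrixP => i j; rewrite !mxE; case: (boolP (i == 0 :> nat)) => [i0|iN0].
  by apply: eq_bigr => l _; rewrite !mxE i0 mulrC.
case E : (insub (i.-1)./2) => [k|] /=.
  transitivity ((J *m (if odd i then u else v) (h k)) j 0).
    by case: (odd i).
  rewrite mxE; apply: eq_bigr => l _.
  by rewrite !mxE (negPf iN0) E /= mulrC.
by rewrite big1 // => l _; rewrite !mxE (negPf iN0) E /= mul0r.
Qed.

Lemma matrix_sum_rank1 d (B : 'M[R]_d) :
  B = \sum_(r : 'I_d * 'I_d) (B r.1 r.2 *: delta_mx r.1 0) *m (delta_mx r.2 (0 : 'I_1))^T.
Proof.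
rewrite [LHS]matrix_sum_delta pair_big /=; apply: eq_bigr => -[i j] _ /=.
by rewrite trmx_delta -scalemxAl mul_delta_mx.
Qed.

(** A change of frame multiplies each of the expanded determinants by J^T. *)
Lemma wedge_pow_top_congr (d : nat) (J B : 'M[R]_d.+1) (a : 'cV[R]_d.+1) :
  ~~ odd d ->
  wedge_pow_top (J *m a) (pull2 J B) = \det J * wedge_pow_top a B.
Proof.
move=> de; have BE := matrix_sum_rank1 B.
pose u (r : 'I_d.+1 * 'I_d.+1) : 'cV[R]_d.+1 := B r.1 r.2 *: delta_mx r.1 0.
pose v (r : 'I_d.+1 * 'I_d.+1) : 'cV[R]_d.+1 := delta_mx r.2 0.
rewrite (wedge_pow_top_det (u := u) (v := v) a de BE).
rewrite (wedge_pow_top_det (u := fun r => J *m u r) (v := fun r => J *m v r) _ de).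
  rewrite mulrCA; congr (_ * _); rewrite mulr_sumr; apply: eq_bigr => h _.
  by rewrite rows_mx_mul det_mulmx det_tr mulrC.
rewrite /pull2 {1}BE mulmx_sumr mulmx_suml; apply: eq_bigr => r _.
by rewrite trmx_mul !mulmxA.
Qed.

(** A product of g with a dies after wedging with a: it expands into
    determinants with a repeated row a. Both sides are expanded over the same
    indices, with zero vectors at the two additional ones on the right, so that
    they agree term by term. *)
Lemma wedge_pow_top_add_wedge (d : nat) (B : 'M[R]_d.+1) (a g : 'cV[R]_d.+1) :
  ~~ odd d ->
  wedge_pow_top a (B + (g *m a^T - a *m g^T)) = wedge_pow_top a B.
Proof.
move=> de; have BE := matrix_sum_rank1 B.
pose u0 (r : 'I_d.+1 * 'I_d.+1) : 'cV[R]_d.+1 := B r.1 r.2 *: delta_mx r.1 0.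
pose v0 (r : 'I_d.+1 * 'I_d.+1) : 'cV[R]_d.+1 := delta_mx r.2 0.
pose u (x y : 'cV[R]_d.+1) r := match r with
  inl r => u0 r | inr b => if b then x else y end.
pose v (x y : 'cV[R]_d.+1) r := match r with
  inl r => v0 r | inr b => if b then x else y end.
rewrite (wedge_pow_top_det (u := u g a) (v := v a (- g)) _ de); last first.
  rewrite big_sumType /= -BE big_bool /=; congr (_ + (_ + _)).
  by rewrite [(- _)^T]linearN mulmxN.
rewrite (wedge_pow_top_det (u := u 0 0) (v := v 0 0) (B := B) _ de); last first.
  by rewrite big_sumType /= -BE big_bool /= !mul0mx !addr0.
congr (_ * _); apply: eq_bigr => h _.
have [/existsP[k]|/existsPn hl] := boolP [exists k, ~~ (if h k is inl _ then true else false)].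
  case hk : (h k) => [//|b] _.
  have N0 : ord0 != inord k.*2.+1 :> 'I_d.+1.
    by rewrite -val_eqE /= inordK // ltnW // pair_lt.
  have N0' : ord0 != inord k.*2.+2 :> 'I_d.+1.
    by rewrite -val_eqE /= inordK // pair_lt.
  rewrite [RHS](expand_det_row _ (inord k.*2.+1)) [RHS]big1; last first.
    by move=> j _; rewrite rows_mx_odd hk /=; case: b {hk}; rewrite mxE mul0r.
  case: b hk => hk.
    apply: (determinant_alternate N0') => j.
    by rewrite rows_mx_even hk mxE.
  apply: (determinant_alternate N0) => j.
  by rewrite rows_mx_odd hk mxE.
congr (\det _); apply/matrixP => i j; rewrite !mxE; case: ifP => // _.
case: (insub _) => [k|//] /=; have := hl k; rewrite negbK.
by case: (h k) => // r _; case: (odd i).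
Qed.

Lemma wedge_pow_topZl (d : nat) (B : 'M[R]_d.+1) (a : 'cV[R]_d.+1) f :
  wedge_pow_top (f *: a) B = f * wedge_pow_top a B.
Proof.
rewrite /wedge_pow_top mulrCA; congr (_ * _); rewrite mulr_sumr; apply: eq_bigr => s _.
by rewrite mxE mulrCA !mulrA.
Qed.

Lemma wedge_pow_topZr (d : nat) (B : 'M[R]_d.+1) (a : 'cV[R]_d.+1) c :
  wedge_pow_top a (c *: B) = c ^+ d./2 * wedge_pow_top a B.
Proof.
rewrite /wedge_pow_top mulrCA; congr (_ * _); rewrite mulr_sumr; apply: eq_bigr => s _.
under [X in _ * X]eq_bigr => k _ do rewrite mxE.
by rewrite big_split /= prodr_const card_ord mulrCA.
Qed.

(** Since the area form squares to zero, the value is affine in t, and its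
    slope is d./2 + 1 times the top value on the first factor. *)
Lemma wedge_pow_top_area (d : nat) (a : 'cV[R]_(d.+1 + 2)) (B : 'M[R]_(d.+1 + 2)) t :
  ~~ odd d ->
  @wedge_pow_top R (d + 2) a (B + block_mx 0 0 0 (t *: area_mx R)) =
  @wedge_pow_top R (d + 2) a B
    + t * (d./2.+1)%:R * wedge_pow_top (usubmx a) (ulsubmx B).
Proof.
move=> de; rewrite /wedge_pow_top.
have -> : ((d + 2)./2 = d./2.+1)%N by rewrite addn2.
have dm := even_halfK de.
pose U (k : 'I_(d./2.+1)) : 'I_(d.+1 + 2) := @inord (d + 2) k.*2.+1.
pose V (k : 'I_(d./2.+1)) : 'I_(d.+1 + 2) := @inord (d + 2) k.*2.+2.
have UE k : U k = k.*2.+1 :> nat.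
  rewrite inordK //; change (k.*2.+1 < (d + 2).+1)%N; have := ltn_ord k; lia.
have VE k : V k = k.*2.+2 :> nat.
  rewrite inordK //; change (k.*2.+2 < (d + 2).+1)%N; have := ltn_ord k; lia.
pose u (k : 'I_(d./2)) : 'I_d.+1 := inord k.*2.+1.
pose v (k : 'I_(d./2)) : 'I_d.+1 := inord k.*2.+2.
have uE k : u k = k.*2.+1 :> nat by rewrite inordK // ltnW // pair_lt.
have vE k : v k = k.*2.+2 :> nat by rewrite inordK // pair_lt.
have l0 : lshift 2 (ord0 : 'I_d.+1) = ord0 :> 'I_(d + 2).+1 by apply: val_inj.
transitivity ((2 ^+ d./2.+1)^-1 * \sum_(s : 'S_(d.+1 + 2))
    (-1) ^+ s * (\prod_(z <- [:: (ord0 : 'I_d.+1)]) a (s (lshift 2 z)) 0) *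
    \prod_(k < d./2.+1) (B + block_mx 0 0 0 (t *: area_mx R)) (s (U k)) (s (V k))).
  by congr (_ * _); apply: eq_bigr => s _; rewrite big_seq1 l0.
rewrite (@alt_sum_area R d.+1 d./2 [:: ord0] u v U V (fun i => a i 0) B t).
- rewrite mulrDr; congr (_ + _).
    by congr (_ * _); apply: eq_bigr => s _; rewrite big_seq1 l0.
  rewrite [RHS]mulrA mulrA.
  have -> : \sum_(s : 'S_d.+1) (-1) ^+ s *
      \prod_(z <- [:: ord0]) a (lshift 2 (s z)) 0 *
      \prod_(k < d./2) B (lshift 2 (s (u k))) (lshift 2 (s (v k))) =
    \sum_(s : 'S_d.+1) (-1) ^+ s * usubmx a (s ord0) 0 *
      \prod_(k < d./2) ulsubmx B (s (u k)) (s (v k)).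
    apply: eq_bigr => s _; rewrite big_seq1 mxE; congr (_ * _).
    by apply: eq_bigr => k _; rewrite !mxE.
  congr (_ * _); rewrite -muln2 natrM exprS; field.
  by rewrite expf_neq0 // pnatr_eq0.
- by move=> k l /(congr1 val)/=; rewrite !UE => kl; apply: val_inj => /=; lia.
- by move=> k l /(congr1 val)/=; rewrite !VE => kl; apply: val_inj => /=; lia.
- by move=> k l; rewrite -val_eqE /= UE VE; lia.
- by move=> k z; rewrite inE => /eqP ->; rewrite -!val_eqE /= UE VE.
- by move=> k; apply: val_inj; rewrite /= UE uE.
- by move=> k; apply: val_inj; rewrite /= VE vE.
- by apply: val_inj; rewrite /= UE /=; lia.
- by apply: val_inj; rewrite /= VE /=; lia.
Qed.

(** The part of degree zero in t vanishes, the last two rows of the matrix being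
    zero there. *)
Lemma pow_top_area (d : nat) (B : 'M[R]_d.+1) t :
  odd d ->
  @pow_top R (d + 2) (block_mx B 0 0 (t *: area_mx R)) =
  t * ((d.+1)./2.+1)%:R * pow_top B.
Proof.
move=> dodd; rewrite /pow_top.
have -> : ((d + 2).+1./2 = (d.+1)./2.+1)%N by rewrite addn2.
set m := (d.+1)./2.
have dm : m.*2 = d.+1 by rewrite /m even_halfK //= dodd.
pose U (k : 'I_m.+1) : 'I_(d.+1 + 2) := @inord (d + 2) k.*2.
pose V (k : 'I_m.+1) : 'I_(d.+1 + 2) := @inord (d + 2) k.*2.+1.
have UE k : U k = k.*2 :> nat.
  rewrite inordK //; change (k.*2 < (d + 2).+1)%N; have := ltn_ord k; lia.
have VE k : V k = k.*2.+1 :> nat.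
  rewrite inordK //; change (k.*2.+1 < (d + 2).+1)%N; have := ltn_ord k; lia.
pose u (k : 'I_m) : 'I_d.+1 := inord k.*2.
pose v (k : 'I_m) : 'I_d.+1 := inord k.*2.+1.
have uE k : u k = k.*2 :> nat by rewrite inordK //; have := ltn_ord k; lia.
have vE k : v k = k.*2.+1 :> nat by rewrite inordK //; have := ltn_ord k; lia.
pose B0 : 'M[R]_(d.+1 + 2) := block_mx B 0 0 0.
have -> : block_mx B 0 0 (t *: area_mx R) = B0 + block_mx 0 0 0 (t *: area_mx R).
  by rewrite add_block_mx !addr0 !add0r.
transitivity ((2 ^+ m.+1)^-1 * \sum_(s : 'S_(d.+1 + 2))
    (-1) ^+ s * (\prod_(z <- ([::] : seq 'I_d.+1)) 0) *
    \prod_(k < m.+1) (B0 + block_mx 0 0 0 (t *: area_mx R)) (s (U k)) (s (V k))).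
  by congr (_ * _); apply: eq_bigr => s _; rewrite big_nil mulr1.
rewrite (@alt_sum_area R d.+1 m [::] u v U V (fun i => 0) B0 t).
- rewrite [X in X + _]big1; last first.
    (* Some pair of every permutation contains the zero row of B0. *)
    move=> s _; pose i := (s^-1)%g (rshift d.+1 (0 : 'I_2)).
    have im : (i./2 < m.+1)%N by have := ltn_ord i; lia.
    rewrite (bigD1 (Ordinal im)) //=.
    suff -> : B0 (s (U (Ordinal im))) (s (V (Ordinal im))) = 0 by rewrite mul0r mulr0.
    have [io|ie] := boolP (odd i).
      have -> : V (Ordinal im) = i by apply: ord_inj; rewrite /= VE /=; lia.
      rewrite /i permKV; case: (split_ordP (s (U (Ordinal im)))) => j ->.
        by rewrite block_mxEur mxE.
      by rewrite block_mxEdr mxE.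
    have -> : U (Ordinal im) = i by apply: ord_inj; rewrite /= UE /=; lia.
    rewrite /i permKV; case: (split_ordP (s (V (Ordinal im)))) => j ->.
      by rewrite block_mxEdl mxE.
    by rewrite block_mxEdr mxE.
  rewrite add0r mulrA [RHS]mulrA.
  have -> : \sum_(s : 'S_d.+1) (-1) ^+ s *
      \prod_(z <- ([::] : seq 'I_d.+1)) 0 *
      \prod_(k < m) B0 (lshift 2 (s (u k))) (lshift 2 (s (v k))) =
    \sum_(s : 'S_d.+1) (-1) ^+ s * \prod_(k < m) B (s (u k)) (s (v k)).
    apply: eq_bigr => s _; rewrite big_nil mulr1; congr (_ * _).
    by apply: eq_bigr => k _; rewrite block_mxEul.
  congr (_ * _); rewrite -muln2 natrM exprS; field.
  by rewrite expf_neq0 // pnatr_eq0.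
- by move=> k l /(congr1 val)/=; rewrite !UE => kl; apply: val_inj => /=; lia.
- by move=> k l /(congr1 val)/=; rewrite !VE => kl; apply: val_inj => /=; lia.
- by move=> k l; rewrite -val_eqE /= UE VE; lia.
- by [].
- by move=> k; apply: val_inj; rewrite /= UE uE.
- by move=> k; apply: val_inj; rewrite /= VE vE.
- by apply: val_inj; rewrite /= UE /=; lia.
- by apply: val_inj; rewrite /= VE /=; lia.
Qed.

End Wedge.
End TopForms.

(** * Partial derivatives of smooth functions *)

Section PartialDerivatives.
Import Order.TTheory GRing.Theory Num.Theory numFieldNormedType.Exports.
Local Open Scope classical_set_scope.
Local Open Scope ring_scope.
Variable R : realType.

Lemma near_right_ray d (x v : 'rV[R]_d) (P : set 'rV[R]_d) :
  (\forall y \near x, P y) -> \forall h \near (0 : R)^'+, P (x + h *: v).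
Proof.
move=> xP.
have c : (fun h : R => x + h *: v) h @[h --> (0 : R)] --> x.
  have : (fun h : R => x + h *: v) h @[h --> (0 : R)] --> x + 0 *: v.
    by apply: cvgD; [exact: cvg_cst|exact: scalel_continuous].
  by rewrite scale0r addr0.
exact: (@cvg_within _ (nbhs (0 : R)) _ (fun u => 0 < u) (fun h => P (x + h *: v)) (c _ xP)).
Qed.

Lemma pd_near_eq d (i : 'I_d) (f g : 'rV[R]_d -> R) x :
  f x = g x ->
  (\forall h \near (0 : R)^'+, f (x + h *: delta_mx 0 i) = g (x + h *: delta_mx 0 i)) ->
  pd i f x = pd i g x.
Proof.
move=> fgx fg; rewrite /pd; congr (lim _).
rewrite eqEsubset; split; apply/near_eq_cvg; near=> h; rewrite fgx; congr (_ * (_ - _)).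
  by near: h.
by apply/esym; near: h.
Unshelve. all: by end_near. Qed.

Lemma pd_locally_eq d (i : 'I_d) (f g : 'rV[R]_d -> R) x :
  (\forall y \near x, f y = g y) -> pd i f x = pd i g x.
Proof.
move=> fg; apply: pd_near_eq; first exact: nbhs_singleton fg.
exact: near_right_ray fg.
Qed.

Lemma pd_derive d (i : 'I_d) (f : 'rV[R]_d -> R) x :
  derivable f x (delta_mx 0 i) -> pd i f x = 'D_(delta_mx 0 i) f x.
Proof.
move=> dv; rewrite /derive (cvg_at_rightE _ _ dv) /pd.
have -> : (fun h : R => h^-1 * (f (x + h *: delta_mx 0 i) - f x)) =
    (fun h : R => h^-1 *: ((f \o shift x) (h *: delta_mx 0 i) - f x)).
  by apply/funext => h /=; rewrite [x + _]addrC.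
by [].
Qed.

Lemma smooth_on_nbhs d (D : set 'rV[R]_d) (f : 'rV[R]_d -> R) x :
  nbhs x D -> smooth_on D f -> exists U g,
    [/\ open U, U x, U `<=` D, smooth_open U g & forall y, U y -> g y = f y].
Proof.
move=> xD /(_ x (nbhs_singleton xD)) [U [g [oU Ux sg gf]]].
exists (U `&` interior D), g; split => //.
- by apply: openI => //; exact: open_interior.
- by move=> y [_] /interior_subset.
- by move=> s y [Uy _]; exact: sg.
- by move=> y [Uy /interior_subset Dy]; exact: gf.
Qed.

Lemma smooth_open_differentiable d (U : set 'rV[R]_d) (g : 'rV[R]_d -> R) x :
  smooth_open U g -> U x -> differentiable g x.
Proof. by move=> sg Ux; exact: (sg [::]). Qed.

Lemma smooth_open_derive d (U : set 'rV[R]_d) (g : 'rV[R]_d -> R) i :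
  smooth_open U g -> smooth_open U (fun y => 'D_(delta_mx 0 i) g y).
Proof.
move=> sg s x Ux; have := sg (rcons s i) x Ux.
by rewrite foldr_rcons.
Qed.

Lemma smooth_on_pd d (D : set 'rV[R]_d) (f : 'rV[R]_d -> R) i :
  open D -> smooth_on D f -> smooth_on D (pd i f).
Proof.
move=> oD sf x Dx.
have [U [g [oU Ux UD sg gf]]] := smooth_on_nbhs (open_nbhs_nbhs (conj oD Dx)) sf.
exists U, (fun y => 'D_(delta_mx 0 i) g y); split => //.
  exact: smooth_open_derive.
move=> y Uy _; rewrite -(pd_derive (diff_derivable (smooth_open_differentiable sg Uy))).
apply: pd_locally_eq; near=> z; apply: gf; near: z.
exact: open_nbhs_nbhs.
Unshelve. all: by end_near. Qed.

Lemma smooth_on_cvg d (T : Type) (F : set_system T) (FF : Filter F)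
  (D : set 'rV[R]_d) (f : 'rV[R]_d -> R) (u : T -> 'rV[R]_d) x :
  smooth_on D f -> D x -> u @ F --> x -> (\forall t \near F, D (u t)) ->
  f (u t) @[t --> F] --> f x.
Proof.
move=> sf Dx ux Du; have [U [g [oU Ux sg gf]]] := sf x Dx.
rewrite -(gf x Ux Dx).
have gu : g (u t) @[t --> F] --> g x.
  have cg : {for x, continuous g}.
    by apply: differentiable_continuous; exact: smooth_open_differentiable sg Ux.
  exact: (cvg_comp u g ux cg).
apply: cvg_trans gu; apply: near_eq_cvg; near=> t.
apply: gf; last by near: t.
by near: t; apply: ux; exact: open_nbhs_nbhs.
Unshelve. all: by end_near. Qed.

Lemma is_derive_ray d (f : 'rV[R]_d -> R) (p v : 'rV[R]_d) t :
  differentiable f (p + t *: v) ->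
  is_derive t (1 : R) (fun s => f (p + s *: v)) ('D_v f (p + t *: v)).
Proof.
move=> df; have dv := @diff_derivable _ _ _ f _ v df.
have E : (fun h : R => h^-1 *: (((fun s : R => f (p + s *: v)) \o shift t) (h *: 1)
    - f (p + t *: v))) =
    (fun h : R => h^-1 *: ((f \o shift (p + t *: v)) (h *: v) - f (p + t *: v))).
  apply/funext => h /=; congr (_ *: (f _ - _)).
  by rewrite [_%:A]mulr1 scalerDl addrCA.
apply: DeriveDef; first by rewrite /derivable E.
by rewrite /derive E.
Qed.

(** The mean value theorem in the direction v, then in the direction w. *)
Lemma second_difference d (f : 'rV[R]_d -> R) (x v w : 'rV[R]_d) (h : R) :
  0 <= h ->
  (forall a b, 0 <= a <= h -> 0 <= b <= h ->
     differentiable f (x + a *: v + b *: w) /\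
     differentiable (fun y => 'D_v f y) (x + a *: v + b *: w)) ->
  exists a b, [/\ 0 <= a <= h, 0 <= b <= h &
    f (x + h *: v + h *: w) - f (x + h *: v) - f (x + h *: w) + f x =
    'D_w (fun y => 'D_v f y) (x + a *: v + b *: w) * h ^+ 2].
Proof.
move=> h0 df.
have hh : 0 <= h <= h by rewrite h0 lexx.
have h00 : 0 <= (0 : R) <= h by rewrite h0 lexx.
pose phi t := f (x + h *: w + t *: v) - f (x + t *: v).
pose dphi t := 'D_v f (x + h *: w + t *: v) - 'D_v f (x + t *: v).
have dphiP t : 0 <= t <= h -> is_derive t (1 : R) phi (dphi t).
  move=> th; apply: is_deriveB; apply: is_derive_ray.
    by have [] := df t h th hh; rewrite addrAC.
  by have [] := df t 0 th h00; rewrite scale0r addr0.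
have [||a ah phiE] := @MVT_segment R phi dphi 0 h h0.
- by move=> t; rewrite in_itv /= => /andP[t0 th]; apply: dphiP; rewrite !ltW.
- apply: derivable_within_continuous => t; rewrite in_itv /= => th.
  by have [] := dphiP t th.
pose psi t := 'D_v f (x + a *: v + t *: w).
pose dpsi t := 'D_w (fun y => 'D_v f y) (x + a *: v + t *: w).
rewrite in_itv /= in ah.
have dpsiP t : 0 <= t <= h -> is_derive t (1 : R) psi (dpsi t).
  by move=> th; apply: is_derive_ray; have [] := df a t ah th.
have [||b bh psiE] := @MVT_segment R psi dpsi 0 h h0.
- by move=> t; rewrite in_itv /= => /andP[t0 th]; apply: dpsiP; rewrite !ltW.
- apply: derivable_within_continuous => t; rewrite in_itv /= => th.
  by have [] := dpsiP t th.
rewrite in_itv /= in bh.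
exists a, b; split=> //.
move: phiE; have -> : dphi a = psi h - psi 0.
  by rewrite /dphi /psi scale0r addr0 addrAC.
rewrite psiE /phi !subr0 !scale0r !addr0 => phiE.
rewrite expr2 mulrA -phiE [x + h *: w + _]addrAC; ring.
Qed.

(** Dividing Delta h by h^2 and letting h tend to 0 gives both values. *)
Lemma second_difference_limit_uniq d (U : set 'rV[R]_d) (D1 D2 : 'rV[R]_d -> R)
  (x v w : 'rV[R]_d) (Delta : R -> R) :
  nbhs x U -> {for x, continuous D1} -> {for x, continuous D2} ->
  (forall h : R, 0 <= h ->
     (forall a b, 0 <= a <= h -> 0 <= b <= h -> U (x + a *: v + b *: w)) ->
     (exists a b, [/\ 0 <= a <= h, 0 <= b <= h &
        Delta h = D1 (x + a *: v + b *: w) * h ^+ 2]) /\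
     (exists a b, [/\ 0 <= a <= h, 0 <= b <= h &
        Delta h = D2 (x + a *: v + b *: w) * h ^+ 2])) ->
  D1 x = D2 x.
Proof.
move=> xU c1 c2 DeltaP.
apply/eqP; rewrite -subr_eq0 -normr_le0; apply/ler_addgt0Pr => e e0.
rewrite add0r.
have e20 : 0 < e / 2 by rewrite divr_gt0.
have n1 : \forall y \near x, `|D1 x - D1 y| < e / 2.
  by move/cvgrPdist_lt : c1 => /(_ _ e20).
have n2 : \forall y \near x, `|D2 x - D2 y| < e / 2.
  by move/cvgrPdist_lt : c2 => /(_ _ e20).
have /nbhs_ballP[r r0 rP] : nbhs x (fun y => [/\ U y,
   `|D1 x - D1 y| < e / 2 & `|D2 x - D2 y| < e / 2]).
  by apply: filterS3 xU n1 n2 => y; exact: And3.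
(* For this h the whole parallelogram lies in the ball of radius r. *)
pose h := r / 2 / (1 + `|v| + `|w|).
have N0 : 0 < 1 + `|v| + `|w| by rewrite -addrA ltr_pwDl // addr_ge0.
have h0 : 0 < h by rewrite !divr_gt0.
have inb a b : 0 <= a <= h -> 0 <= b <= h -> ball x r (x + a *: v + b *: w).
  move=> /andP[a0 ah] /andP[b0 bh]; rewrite -ball_normE /ball_ /=.
  rewrite -addrA opprD addrA subrr sub0r normrN.
  apply: (@le_lt_trans _ _ (h * (1 + `|v| + `|w|))); last first.
    by rewrite /h divfK ?gt_eqF // ltr_pdivrMr // ltr_pMr // ltr1n.
  rewrite (le_trans (ler_normD _ _)) // !normrZ (ger0_norm a0) (ger0_norm b0).
  have av : a * `|v| <= h * `|v| by rewrite ler_wpM2r.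
  have bw : b * `|w| <= h * `|w| by rewrite ler_wpM2r.
  by rewrite !mulrDr mulr1; lra.
have [|[a [b [ah bh E1]]] [a' [b' [ah' bh' E2]]]] := DeltaP h (ltW h0).
  by move=> a b ha hb; have [] := rP _ (inb a b ha hb).
have [_ + _] := rP _ (inb a b ah bh); have [_ _] := rP _ (inb a' b' ah' bh').
have -> : D1 (x + a *: v + b *: w) = D2 (x + a' *: v + b' *: w).
  have h20 : h ^+ 2 != 0 by rewrite expf_neq0 // gt_eqF.
  by apply: (mulIf h20); rewrite -E1 -E2.
rewrite ltr_norml => /andP[A B]; rewrite ltr_norml => /andP[C D].
by rewrite ler_norml; apply/andP; split; lra.
Qed.

(** Both mixed derivatives are limits of the same second difference quotient. *)
Lemma mixed_derive_sym d (U : set 'rV[R]_d) (f : 'rV[R]_d -> R) (x v w : 'rV[R]_d) :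
  nbhs x U ->
  (forall y, U y -> [/\ differentiable f y, differentiable (fun y => 'D_v f y) y &
                        differentiable (fun y => 'D_w f y) y]) ->
  {for x, continuous (fun y => 'D_w (fun z => 'D_v f z) y)} ->
  {for x, continuous (fun y => 'D_v (fun z => 'D_w f z) y)} ->
  'D_w (fun z => 'D_v f z) x = 'D_v (fun z => 'D_w f z) x.
Proof.
move=> xU df c1 c2.
apply: (@second_difference_limit_uniq _ U (fun y => 'D_w (fun z => 'D_v f z) y)
  (fun y => 'D_v (fun z => 'D_w f z) y) x v w
  (fun h => f (x + h *: v + h *: w) - f (x + h *: v) - f (x + h *: w) + f x)
  xU c1 c2) => h h0 inU; split.
  apply: second_difference => // a b ah bh.
  by have [] := df _ (inU _ _ ah bh).
have [|a [b [ah bh E]]] := @second_difference d f x w v h h0.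
  by move=> a b ah bh; rewrite addrAC; have [] := df _ (inU _ _ bh ah).
have vw (s t : R) : x + s *: v + t *: w = x + t *: w + s *: v by rewrite addrAC.
exists b, a; split; [exact: bh|exact: ah|].
by rewrite !vw; apply: etrans E; congr (_ + _); rewrite addrAC.
Qed.

Lemma smooth_open_derive_sym d (U : set 'rV[R]_d) (f : 'rV[R]_d -> R) x i j :
  open U -> U x -> smooth_open U f ->
  'D_(delta_mx 0 i) (fun z => 'D_(delta_mx 0 j) f z) x =
  'D_(delta_mx 0 j) (fun z => 'D_(delta_mx 0 i) f z) x.
Proof.
move=> oU Ux sf; apply: (@mixed_derive_sym _ U).
- exact: open_nbhs_nbhs.
- move=> y Uy; split; [exact: (sf [::])|exact: (sf [:: j])|exact: (sf [:: i])].
- by apply: differentiable_continuous; exact: (sf [:: i; j]).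
- by apply: differentiable_continuous; exact: (sf [:: j; i]).
Qed.

End PartialDerivatives.

(** * The chain rule and the exterior derivative *)

Section ChainRule.
Import Order.TTheory GRing.Theory Num.Theory numFieldNormedType.Exports.
Local Open Scope classical_set_scope.
Local Open Scope ring_scope.
Variable R : realType.

Lemma nbhs_open d (D : set 'rV[R]_d) x : open D -> D x -> nbhs x D.
Proof. by move=> oD Dx; apply: open_nbhs_nbhs. Qed.

(** At an interior point the entries of F are themselves smooth near x, so one
    neighborhood serves all of them. *)
Lemma smooth_mx_on_nbhs d p q (D : set 'rV[R]_d) (F : 'rV[R]_d -> 'M[R]_(p, q)) x :
  nbhs x D -> smooth_mx_on D F -> exists U (G : 'rV[R]_d -> 'M[R]_(p, q)),
    [/\ open U, U x, U `<=` D, (forall i j, smooth_open U (fun y => G y i j)) &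
        forall y, U y -> G y = F y].
Proof.
move=> xD sF.
have /choice[Ug UgP] : forall ij : 'I_p * 'I_q,
    exists Ug : set 'rV[R]_d * ('rV[R]_d -> R),
    [/\ open Ug.1, Ug.1 x, Ug.1 `<=` D, smooth_open Ug.1 Ug.2 &
        forall y, Ug.1 y -> Ug.2 y = F y ij.1 ij.2].
  by move=> [i j]; have [U [g gP]] := smooth_on_nbhs xD (sF i j); exists (U, g).
exists (interior (D `&` [set y | forall ij, (Ug ij).1 y])).
exists (fun y => \matrix_(i, j) (Ug (i, j)).2 y); split.
- exact: open_interior.
- have allU : \forall y \near x, forall ij, (Ug ij).1 y.
    apply: (@filter_forall _ _ (fun ij => (Ug ij).1) (nbhs x)) => ij.
    by have [oU Ux _ _ _] := UgP ij; exact: nbhs_open.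
  exact: filterI xD allU.
- by move=> y /interior_subset[].
- move=> i j s y /interior_subset[_ Uy].
  have -> : (fun z => (\matrix_(i, j) (Ug (i, j)).2 z) i j) = (Ug (i, j)).2.
    by apply/funext => z; rewrite mxE.
  by have [_ _ _ sg _] := UgP (i, j); exact: sg.
- move=> y /interior_subset[_ Uy]; apply/matrixP => i j; rewrite mxE.
  by have [_ _ _ _ ->] := UgP (i, j).
Qed.

Lemma differentiable_row d k (F : 'rV[R]_d -> 'rV[R]_k) x :
  (forall j, differentiable (fun y => F y 0 j) x) -> differentiable F x.
Proof.
move=> dF.
have -> : F = \sum_(j < k) (fun y => F y 0 j *: (delta_mx 0 j : 'rV[R]_k)).
  by apply/funext => y; rewrite fct_sumE -row_sum_delta.
by apply: differentiable_sum => j; apply: differentiableZl.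
Qed.

Lemma smooth_on_derivable d (D : set 'rV[R]_d) (f : 'rV[R]_d -> R) x v :
  nbhs x D -> smooth_on D f -> derivable f x v.
Proof.
move=> xD sf; have [U [g [oU Ux UD sg gf]]] := smooth_on_nbhs xD sf.
apply: (@near_eq_derivable _ _ _ g); last first.
  by apply: diff_derivable; exact: smooth_open_differentiable sg Ux.
by near=> y; apply: gf; near: y; exact: nbhs_open.
Unshelve. all: by end_near. Qed.

Lemma cvg_row (T : Type) (F : set_system T) (FF : Filter F) k (u : T -> 'rV[R]_k) (x : 'rV[R]_k) :
  (forall j, u t 0 j @[t --> F] --> x 0 j) -> u @ F --> x.
Proof.
move=> ux A /= [P xP PA]; rewrite /nbhs /=.
have : \forall t \near F, forall j, P 0 j (u t 0 j).
  apply: (@filter_forall _ _ (fun j t => P 0 j (u t 0 j)) F) => j.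
    exact: (ux j _ (xP 0 j)).
by apply: filterS => t Pt; apply: PA => i j; rewrite (ord1 i).
Qed.

Lemma smooth_row_cvg d k (D : set 'rV[R]_d) (F : 'rV[R]_d -> 'rV[R]_k) x :
  nbhs x D -> smooth_mx_on D F -> {for x, continuous F}.
Proof.
move=> xD sF; apply: (@cvg_row _ (nbhs x) (nbhs_filter x)) => j.
exact: (@smooth_on_cvg _ _ _ (nbhs x) (nbhs_filter x) D _ id x (sF 0 j)
  (nbhs_singleton xD) _ xD).
Qed.

Section Composition.
Variables (d k : nat) (D : set 'rV[R]_d) (S : set 'rV[R]_k).
Variables (F : 'rV[R]_d -> 'rV[R]_k) (x : 'rV[R]_d).
Hypotheses (xD : nbhs x D) (sF : smooth_mx_on D F).
Hypothesis FS : \forall y \near x, S (F y).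

(** Passing to smooth extensions makes both maps differentiable in the full
    sense, also where T is only given on a half-space. *)
Lemma comp_smooth_local (T : 'rV[R]_k -> R) : smooth_on S T ->
  exists (g : 'rV[R]_k -> R) (G : 'rV[R]_d -> 'rV[R]_k),
   [/\ (\forall z \near F x, S z -> g z = T z), differentiable g (F x),
       (\forall y \near x, T (F y) = g (G y)), (\forall y \near x, F y = G y) &
       (forall j, differentiable (fun y => G y 0 j) x)].
Proof.
move=> sT; have [U [G [oU Ux UD sG GF]]] := smooth_mx_on_nbhs xD sF.
have [V [g [oV Vx sg gT]]] := sT (F x) (nbhs_singleton FS).
have FG : \forall y \near x, F y = G y.
  by near=> y; apply/esym/GF; near: y; exact: nbhs_open.
exists g, G; split => //.
- by near=> z; move=> Sz; apply: gT => //; near: z; exact: nbhs_open.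
- exact: smooth_open_differentiable sg Vx.
- near=> y; have Fy : F y = G y by near: y.
  rewrite -Fy; apply/esym/gT; last by near: y.
  by near: y; apply: (smooth_row_cvg xD sF); exact: nbhs_open.
- by move=> j; exact: smooth_open_differentiable (sG 0 j) Ux.
Unshelve. all: by end_near. Qed.

Lemma derivable_smooth_comp (T : 'rV[R]_k -> R) v : smooth_on S T ->
  derivable (fun y => T (F y)) x v.
Proof.
move=> /comp_smooth_local[g [G [gT dg TF FG dG]]].
apply: (@near_eq_derivable _ _ _ (g \o G)).
  by near=> y; apply/esym; near: y.
apply: diff_derivable; apply: differentiable_comp.
  exact: differentiable_row.
by rewrite -(nbhs_singleton FG).
Unshelve. all: by end_near. Qed.

(** As partial derivatives are taken along positive rays, it is enough that the
    domain of T contains short positive coordinate rays at F x, which a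
    half-space does even at its boundary points. *)
Lemma pd_comp (T : 'rV[R]_k -> R) i : smooth_on S T ->
  (forall j, \forall h \near (0 : R)^'+, S (F x + h *: delta_mx 0 j)) ->
  pd i (fun y => T (F y)) x = \sum_j pd i (fun y => F y 0 j) x * pd j T (F x).
Proof.
move=> sT ray; have [g [G [gT dg TF FG dG]]] := comp_smooth_local sT.
have GFx := nbhs_singleton FG.
have dG' := differentiable_row dG.
have dg' : differentiable g (G x) by rewrite -GFx.
rewrite (pd_locally_eq i TF) (@pd_derive _ _ i (g \o G)); last first.
  by apply: diff_derivable; exact: differentiable_comp.
rewrite deriveE; last exact: differentiable_comp.
have dGi : 'd G x (delta_mx 0 i) =
    \row_j 'D_(delta_mx 0 i) (fun y => G y 0 j) x.
  rewrite -deriveE // derive_mx; last exact: diff_derivable.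
  by apply/rowP => j; rewrite !mxE.
rewrite diff_comp //= dGi [X in 'd g _ X]row_sum_delta linear_sum; apply: eq_bigr => j _.
rewrite mxE linearZ /= -(@deriveE _ _ _ g (G x) (delta_mx 0 j) dg') -GFx.
congr (_ * _).
  rewrite (@pd_locally_eq _ _ i _ (fun y => G y 0 j)).
    by rewrite pd_derive //; exact: diff_derivable.
  by apply: filterS FG => y ->.
rewrite -(pd_derive (diff_derivable dg)).
apply: pd_near_eq; first by rewrite (nbhs_singleton gT) //; exact: nbhs_singleton FS.
near=> h; have Sh : S (F x + h *: delta_mx 0 j) by near: h; exact: ray.
have : S (F x + h *: delta_mx 0 j) -> g (F x + h *: delta_mx 0 j) = T (F x + h *: delta_mx 0 j).
  by near: h; exact: near_right_ray gT.
exact.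
Unshelve. all: by end_near. Qed.

End Composition.

Lemma jac_comp d k l (D : set 'rV[R]_d) (S : set 'rV[R]_k)
  (F : 'rV[R]_d -> 'rV[R]_k) (T : 'rV[R]_k -> 'rV[R]_l) x :
  nbhs x D -> smooth_mx_on D F -> (\forall y \near x, S (F y)) ->
  smooth_mx_on S T ->
  (forall j, \forall h \near (0 : R)^'+, S (F x + h *: delta_mx 0 j)) ->
  jac (fun y => T (F y)) x = jac F x *m jac T (F x).
Proof.
move=> xD sF FS sT ray; apply/matrixP => i j; rewrite !mxE.
rewrite (pd_comp xD sF FS i (sT 0 j) ray).
by apply: eq_bigr => m _; rewrite !mxE.
Qed.

Lemma smooth_on_pd_sym d (D : set 'rV[R]_d) (f : 'rV[R]_d -> R) x i j :
  open D -> D x -> smooth_on D f -> pd i (pd j f) x = pd j (pd i f) x.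
Proof.
move=> oD Dx sf; have [U [g [oU Ux UD sg gf]]] := smooth_on_nbhs (nbhs_open oD Dx) sf.
have pdU m y : U y -> pd m f y = 'D_(delta_mx 0 m) g y.
  move=> Uy; rewrite -(pd_derive (diff_derivable (smooth_open_differentiable sg Uy))).
  by apply: pd_locally_eq; near=> z; apply/esym/gf; near: z; exact: nbhs_open.
have pd2 m l : pd m (pd l f) x = 'D_(delta_mx 0 m) (fun z => 'D_(delta_mx 0 l) g z) x.
  rewrite (@pd_locally_eq _ _ m _ (fun z => 'D_(delta_mx 0 l) g z)).
    apply: pd_derive; apply: diff_derivable.
    exact: smooth_open_differentiable (smooth_open_derive l sg) Ux.
  by near=> y; apply: pdU; near: y; exact: nbhs_open.
by rewrite !pd2; exact: smooth_open_derive_sym oU Ux sg.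
Unshelve. all: by end_near. Qed.

Lemma pd_sumM d k (i : 'I_d) (f g : 'I_k -> 'rV[R]_d -> R) x :
  (forall m, derivable (f m) x (delta_mx 0 i)) ->
  (forall m, derivable (g m) x (delta_mx 0 i)) ->
  pd i (fun y => \sum_m f m y * g m y) x =
  \sum_m (pd i (f m) x * g m x + f m x * pd i (g m) x).
Proof.
move=> df dg.
have -> : (fun y => \sum_m f m y * g m y) = \sum_m (f m * g m).
  by apply/funext => y; rewrite fct_sumE.
have dfg m : derivable (f m * g m) x (delta_mx 0 i) by apply: derivableM.
rewrite pd_derive; last exact: derivable_sum.
rewrite derive_sum //; apply: eq_bigr => m _.
rewrite deriveM // !pd_derive // addrC; congr (_ + _).
by rewrite [LHS]mulrC.
Qed.

(** The second derivatives of T enter symmetrically, because mixed partial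
    derivatives commute, and cancel. *)
Lemma ext_d1_pullback d k (D : set 'rV[R]_d) (S : set 'rV[R]_k)
  (T : 'rV[R]_d -> 'rV[R]_k) (a : 'rV[R]_d -> 'cV[R]_d) (b : 'rV[R]_k -> 'cV[R]_k) x :
  open D -> D x -> smooth_mx_on D T -> open S -> smooth_mx_on S b ->
  (forall y, D y -> S (T y)) ->
  (forall y, D y -> a y = jac T y *m b (T y)) ->
  ext_d1 a x = pull2 (jac T x) (ext_d1 b (T x)).
Proof.
move=> oD Dx sT oS sb TS ab.
have xD := nbhs_open oD Dx.
have FS : \forall y \near x, S (T y).
  by near=> y; apply: TS; near: y.
pose P i j m := pd i (pd j (fun y => T y 0 m)) x.
pose J i m := pd i (fun y => T y 0 m) x.
pose Q l m := pd l (fun z => b z m 0) (T x).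
have pda i j : pd i (fun y => a y j 0) x =
    \sum_m (P i j m * b (T x) m 0 + J j m * \sum_l J i l * Q l m).
  rewrite (@pd_locally_eq _ _ i _
      (fun y => \sum_m pd j (fun y => T y 0 m) y * b (T y) m 0)); last first.
    near=> y; rewrite ab ?mxE; last by near: y.
    by apply: eq_bigr => m _; rewrite mxE.
  rewrite pd_sumM; last 2 first.
  - move=> m; apply: (@smooth_on_derivable d D); [exact: xD|exact: (smooth_on_pd j oD (sT 0 m))].
  - by move=> m; apply: (@derivable_smooth_comp _ _ D S T x xD sT FS (fun z => b z m 0)); exact: (sb m 0).
  apply: eq_bigr => m _; congr (_ + _ * _).
  apply: (pd_comp xD sT FS i (sb m 0)) => l.
  by apply: near_right_ray; apply: nbhs_open => //; exact: TS.
apply/matrixP => i j; rewrite mxE !pda -sumrB.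
rewrite /pull2 mxE.
transitivity (\sum_m (J j m * (\sum_l J i l * Q l m) - J i m * (\sum_l J j l * Q l m))).
  apply: eq_bigr => m _; rewrite /P (smooth_on_pd_sym i j oD Dx (sT 0 m)).
  by rewrite opprD addrACA subrr add0r.
under [RHS]eq_bigr => m _.
  rewrite [(jac _ _ *m _) _ _]mxE [_^T _ _]mxE mulr_suml.
  under eq_bigr => l _ do rewrite !mxE mulrBr mulrBl.
  rewrite sumrB; over.
rewrite !sumrB; congr (_ - _).
  apply: eq_bigr => m _; rewrite mulr_sumr; apply: eq_bigr => l _.
  by rewrite mulrC.
rewrite [RHS]exchange_big /=; apply: eq_bigr => m _; rewrite mulr_sumr.
apply: eq_bigr => l _; rewrite -!mulrA; congr (_ * _).
by rewrite mulrC.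
Unshelve. all: by end_near. Qed.

End ChainRule.

(** * Calculus on products of coordinate spaces *)

Section ProductCoordinates.
Import Order.TTheory GRing.Theory Num.Theory numFieldNormedType.Exports.
Local Open Scope classical_set_scope.
Local Open Scope ring_scope.
Variable R : realType.

Lemma lsubmx_deltal d k (i : 'I_d) :
  lsubmx (delta_mx 0 (lshift k i)) = delta_mx 0 i :> 'rV[R]_d.
Proof. by apply/rowP => j; rewrite !mxE eq_lshift. Qed.
Lemma lsubmx_deltar d k (i : 'I_k) :
  lsubmx (delta_mx 0 (rshift d i)) = 0 :> 'rV[R]_d.
Proof. by apply/rowP => j; rewrite !mxE eq_lrshift andbF. Qed.
Lemma rsubmx_deltar d k (i : 'I_k) :
  rsubmx (delta_mx 0 (rshift d i)) = delta_mx 0 i :> 'rV[R]_k.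
Proof. by apply/rowP => j; rewrite !mxE eq_rshift. Qed.
Lemma rsubmx_deltal d k (i : 'I_d) :
  rsubmx (delta_mx 0 (lshift k i)) = 0 :> 'rV[R]_k.
Proof. by apply/rowP => j; rewrite !mxE eq_rlshift andbF. Qed.

Lemma pd_cst d (i : 'I_d) (f : 'rV[R]_d -> R) x :
  (forall h, f (x + h *: delta_mx 0 i) = f x) -> pd i f x = 0.
Proof.
move=> fc; rewrite (@pd_near_eq _ _ i _ (cst (f x))) //; last by near=> h.
by rewrite pd_derive ?derive_cst.
Unshelve. all: by end_near. Qed.

Lemma pd_linear_eq d k (L : {linear 'rV[R]_d -> 'rV[R]_k}) i j (f : 'rV[R]_k -> R) y :
  L (delta_mx 0 i) = delta_mx 0 j -> pd i (fun z => f (L z)) y = pd j f (L y).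
Proof.
move=> Le; rewrite /pd; have -> : (fun h : R => h^-1 *
    (f (L (y + h *: delta_mx 0 i)) - f (L y))) =
    (fun h : R => h^-1 * (f (L y + h *: delta_mx 0 j) - f (L y))).
  by apply/funext => h; rewrite linearD linearZ /= Le.
by [].
Qed.

Lemma pd_linear_eq0 d k (L : {linear 'rV[R]_d -> 'rV[R]_k}) i (f : 'rV[R]_k -> R) y :
  L (delta_mx 0 i) = 0 -> pd i (fun z => f (L z)) y = 0.
Proof. by move=> Le; apply: pd_cst => h; rewrite linearD linearZ /= Le scaler0 addr0. Qed.

Lemma pd_lsubmxl d k (f : 'rV[R]_d -> R) i (y : 'rV[R]_(d + k)) :
  pd (lshift k i) (fun z => f (lsubmx z)) y = pd i f (lsubmx y).
Proof. by apply: (@pd_linear_eq _ _ lsubmx); rewrite /= lsubmx_deltal. Qed.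
Lemma pd_lsubmxr d k (f : 'rV[R]_d -> R) i (y : 'rV[R]_(d + k)) :
  pd (rshift d i) (fun z => f (lsubmx z)) y = 0.
Proof. by apply: (@pd_linear_eq0 _ _ lsubmx); rewrite /= lsubmx_deltar. Qed.
Lemma pd_rsubmxr d k (f : 'rV[R]_k -> R) i (y : 'rV[R]_(d + k)) :
  pd (rshift d i) (fun z => f (rsubmx z)) y = pd i f (rsubmx y).
Proof. by apply: (@pd_linear_eq _ _ rsubmx); rewrite /= rsubmx_deltar. Qed.
Lemma pd_rsubmxl d k (f : 'rV[R]_k -> R) i (y : 'rV[R]_(d + k)) :
  pd (lshift k i) (fun z => f (rsubmx z)) y = 0.
Proof. by apply: (@pd_linear_eq0 _ _ rsubmx); rewrite /= rsubmx_deltal. Qed.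

Lemma jac_row_mx d k d' k' (F : 'rV[R]_d -> 'rV[R]_d') (G : 'rV[R]_k -> 'rV[R]_k')
  (y : 'rV[R]_(d + k)) :
  jac (fun z => row_mx (F (lsubmx z)) (G (rsubmx z))) y =
  block_mx (jac F (lsubmx y)) 0 0 (jac G (rsubmx y)).
Proof.
apply/matrixP => i j; rewrite mxE.
case: (split_ordP j) => j' ->; case: (split_ordP i) => i' ->.
- rewrite block_mxEul mxE -[RHS]pd_lsubmxl; congr (pd _ _ _).
  by apply/funext => z; rewrite row_mxEl.
- rewrite block_mxEdl mxE -[RHS](pd_lsubmxr (fun z => F z 0 j') i' y).
  by congr (pd _ _ _); apply/funext => z; rewrite row_mxEl.
- rewrite block_mxEur mxE -[RHS](pd_rsubmxl (fun z => G z 0 j') i' y).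
  by congr (pd _ _ _); apply/funext => z; rewrite row_mxEr.
- rewrite block_mxEdr mxE -[RHS]pd_rsubmxr; congr (pd _ _ _).
  by apply/funext => z; rewrite row_mxEr.
Qed.

Lemma derive_comp_linear d k (L : {linear 'rV[R]_d -> 'rV[R]_k}) (f : 'rV[R]_k -> R) v y :
  'D_v (fun z => f (L z)) y = 'D_(L v) f (L y).
Proof.
rewrite /derive; have -> : (fun h : R => h^-1 *:
    (((fun z => f (L z)) \o shift y) (h *: v) - f (L y))) =
    (fun h : R => h^-1 *: ((f \o shift (L y)) (h *: L v) - f (L y))).
  by apply/funext => h; congr (_ *: (f _ - _)); rewrite /= linearP.
by [].
Qed.

(** Each iterated derivative of f o L is zero or an iterated derivative of f
    composed with L. *)
Lemma smooth_open_comp_linear d k (L : {linear 'rV[R]_d -> 'rV[R]_k})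
  (U : set 'rV[R]_k) (f : 'rV[R]_k -> R) :
  (forall y, differentiable L y) ->
  (forall i, L (delta_mx 0 i) = 0 \/ exists j, L (delta_mx 0 i) = delta_mx 0 j) ->
  smooth_open U f -> smooth_open (L @^-1` U) (fun y => f (L y)).
Proof.
move=> dL Le sf s.
suff [->|[s' ->]] : foldr (fun i (g : 'rV[R]_d -> R) y => 'D_(delta_mx 0 i) g y)
      (fun y => f (L y)) s = cst 0 \/
    exists s', foldr (fun i (g : 'rV[R]_d -> R) y => 'D_(delta_mx 0 i) g y)
      (fun y => f (L y)) s =
    (fun y => foldr (fun i (g : 'rV[R]_k -> R) y => 'D_(delta_mx 0 i) g y) f s' (L y)).
- by move=> y _; exact: differentiable_cst.
- move=> y Uy; apply: (@differentiable_comp _ _ _ _ L) => //.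
  exact: sf.
elim: s => [|i s [IH|[s' IH]]] /=; first by right; exists [::].
- by left; apply/funext => y; rewrite IH derive_cst.
- case: (Le i) => [L0|[j Lj]].
    by left; apply/funext => y; rewrite IH derive_comp_linear L0 derive0.
  by right; exists (j :: s'); apply/funext => y; rewrite IH derive_comp_linear Lj.
Qed.

Lemma smooth_on_comp_linear d k (L : {linear 'rV[R]_d -> 'rV[R]_k})
  (S : set 'rV[R]_k) (f : 'rV[R]_k -> R) :
  continuous L ->
  (forall i, L (delta_mx 0 i) = 0 \/ exists j, L (delta_mx 0 i) = delta_mx 0 j) ->
  smooth_on S f -> smooth_on (L @^-1` S) (fun y => f (L y)).
Proof.
move=> cL Le sf y Sy; have [U [g [oU Ux sg gf]]] := sf _ Sy.
exists (L @^-1` U), (fun y => g (L y)); split => //.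
- by move/continuousP : cL; apply.
- by apply: smooth_open_comp_linear => // z; exact: linear_differentiable.
- by move=> z Uz Sz; exact: gf.
Qed.

Lemma smooth_on_lsubmx d k (S : set 'rV[R]_d) (f : 'rV[R]_d -> R) :
  smooth_on S f -> smooth_on (lsubmx @^-1` S) (fun y : 'rV[R]_(d + k) => f (lsubmx y)).
Proof.
apply: (@smooth_on_comp_linear _ _ lsubmx); first exact: continuous_lsubmx.
move=> i; case: (split_ordP i) => j ->; last by left; exact: lsubmx_deltar.
by right; exists j; exact: lsubmx_deltal.
Qed.

Lemma smooth_on_rsubmx d k (S : set 'rV[R]_k) (f : 'rV[R]_k -> R) :
  smooth_on S f -> smooth_on (rsubmx @^-1` S) (fun y : 'rV[R]_(d + k) => f (rsubmx y)).
Proof.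
apply: (@smooth_on_comp_linear _ _ rsubmx); first exact: continuous_rsubmx.
move=> i; case: (split_ordP i) => j ->; first by left; exact: rsubmx_deltal.
by right; exists j; exact: rsubmx_deltar.
Qed.

Lemma smooth_on_subset d (S S' : set 'rV[R]_d) (f : 'rV[R]_d -> R) :
  S' `<=` S -> smooth_on S f -> smooth_on S' f.
Proof.
move=> SS sf x /SS Sx; have [U [g [oU Ux sg gf]]] := sf x Sx.
by exists U, g; split => // y Uy /SS; exact: gf.
Qed.

Lemma smooth_on_cst d (S : set 'rV[R]_d) (c : R) : smooth_on S (fun=> c).
Proof.
move=> x _; exists setT, (cst c); split => //; first exact: openT.
move=> s y _; suff [c' ->] : exists c', foldr (fun i (g : 'rV[R]_d -> R) y =>
    'D_(delta_mx 0 i) g y) (cst c) s = cst c' by exact: differentiable_cst.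
elim: s => [|i s [c' IH]] /=; first by exists c.
by exists 0; apply/funext => z; rewrite IH derive_cst.
Qed.

Lemma derive_coord d (j : 'I_d) (v x : 'rV[R]_d) :
  'D_v (fun y : 'rV[R]_d => y 0 j) x = v 0 j.
Proof.
have := @derive_mx _ _ _ _ (@idfun 'rV[R]_d) x v (@derivable_id _ _ _ _).
by rewrite derive_id => /rowP/(_ j); rewrite mxE => ->.
Qed.

Lemma smooth_open_coordD d (j : 'I_d) (c : R) :
  smooth_open [set: 'rV[R]_d] (fun y => y 0 j + c).
Proof.
move=> s x _.
have dg z : differentiable (fun y : 'rV[R]_d => y 0 j + c) z.
  by apply: differentiableD => //; exact: differentiable_coord.
suff [->|[c' ->]] : foldr (fun i (g : 'rV[R]_d -> R) y =>
    'D_(delta_mx 0 i) g y) (fun y => y 0 j + c) s = (fun y => y 0 j + c) \/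
   exists c', foldr (fun i (g : 'rV[R]_d -> R) y =>
    'D_(delta_mx 0 i) g y) (fun y => y 0 j + c) s = cst c'.
- exact: dg.
- exact: differentiable_cst.
elim: s => [|i s [IH|[c' IH]]] /=; [by left|right|right].
  exists ((delta_mx 0 i : 'rV[R]_d) 0 j); apply/funext => z; rewrite IH.
  rewrite [LHS](_ : _ = 'D_(delta_mx 0 i) ((fun y : 'rV[R]_d => y 0 j) + cst c) z) //.
  rewrite deriveD //; last by apply: diff_derivable; exact: differentiable_coord.
  by rewrite derive_coord derive_cst addr0.
by exists 0; apply/funext => z; rewrite IH derive_cst.
Qed.

Lemma pd_coordD d (i j : 'I_d) (c : R) x :
  pd i (fun y : 'rV[R]_d => y 0 j + c) x = (i == j)%:R.
Proof.
rewrite pd_derive; last first.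
  by apply: diff_derivable; exact: (@smooth_open_coordD d j c [::] x).
rewrite [LHS](_ : _ = 'D_(delta_mx 0 i) ((fun y : 'rV[R]_d => y 0 j) + cst c) x) //.
rewrite deriveD //; last by apply: diff_derivable; exact: differentiable_coord.
by rewrite derive_coord derive_cst addr0 mxE eqxx eq_sym.
Qed.

Lemma wedge_pow_top_cvg d (T : Type) (F : set_system T) (FF : Filter F)
  (a : T -> 'cV[R]_d.+1) (B : T -> 'M[R]_d.+1) (a0 : 'cV[R]_d.+1) (B0 : 'M[R]_d.+1) :
  (forall i, a t i 0 @[t --> F] --> a0 i 0) ->
  (forall i j, B t i j @[t --> F] --> B0 i j) ->
  wedge_pow_top (a t) (B t) @[t --> F] --> wedge_pow_top a0 B0.
Proof.
move=> ca cB; apply: cvgM; first exact: cvg_cst.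
apply: (cvg_big (@add_continuous R)) => s _; apply: cvgM.
  by apply: cvgM => //; exact: cvg_cst.
exact: (cvg_big (@mul_continuous R)).
Qed.

End ProductCoordinates.

(** * Restriction of one-forms to fibers *)

Section Fibers.
Import Order.TTheory GRing.Theory Num.Theory numFieldNormedType.Exports.
Local Open Scope classical_set_scope.
Local Open Scope ring_scope.
Variable R : realType.

Lemma row_mx_ray d k (y1 : 'rV[R]_d) (y2 : 'rV[R]_k) i (h : R) :
  row_mx (y1 + h *: delta_mx 0 i) y2 =
  row_mx y1 y2 + h *: delta_mx 0 (lshift k i).
Proof.
rewrite -[delta_mx 0 (lshift k i)]hsubmxK lsubmx_deltal rsubmx_deltal.
by rewrite scale_row_mx add_row_mx scaler0 addr0.
Qed.

Lemma pd_fiber d k (f : 'rV[R]_(d + k) -> R) (y1 : 'rV[R]_d) (y2 : 'rV[R]_k) i :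
  pd i (fun z => f (row_mx z y2)) y1 = pd (lshift k i) f (row_mx y1 y2).
Proof.
rewrite /pd; have -> : (fun h : R => h^-1 *
    (f (row_mx (y1 + h *: delta_mx 0 i) y2) - f (row_mx y1 y2))) =
  (fun h : R => h^-1 *
    (f (row_mx y1 y2 + h *: delta_mx 0 (lshift k i)) - f (row_mx y1 y2))).
  by apply/funext => h; rewrite row_mx_ray.
by [].
Qed.

Lemma derivable_fiber d k (f : 'rV[R]_(d + k) -> R) (y1 : 'rV[R]_d) (y2 : 'rV[R]_k) i :
  derivable f (row_mx y1 y2) (delta_mx 0 (lshift k i)) ->
  derivable (fun z => f (row_mx z y2)) y1 (delta_mx 0 i).
Proof.
rewrite /derivable; have -> : (fun h : R => h^-1 *:
    (((fun z => f (row_mx z y2)) \o shift y1) (h *: delta_mx 0 i) - f (row_mx y1 y2))) =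
  (fun h : R => h^-1 *:
    ((f \o shift (row_mx y1 y2)) (h *: delta_mx 0 (lshift k i)) - f (row_mx y1 y2))).
  apply/funext => h; congr (_ *: (f _ - _)).
  by rewrite /= addrC row_mx_ray addrC.
by [].
Qed.

Lemma ext_d1_fiber d k (a : 'rV[R]_(d + k) -> 'cV[R]_(d + k)) y1 y2 :
  ulsubmx (ext_d1 a (row_mx y1 y2)) =
  ext_d1 (fun z : 'rV[R]_d => usubmx (a (row_mx z y2))) y1.
Proof.
apply/matrixP => i j; rewrite !mxE; congr (_ - _).
  rewrite -(pd_fiber (fun y => a y (lshift k j) 0)); congr (pd _ _ _).
  by apply/funext => z; rewrite mxE.
rewrite -(pd_fiber (fun y => a y (lshift k i) 0)); congr (pd _ _ _).
by apply/funext => z; rewrite mxE.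
Qed.

(** The kernel of a covector consists of the u such that neither u nor - u lies
    in its open half-space, so a and b have the same kernel. *)
Lemma covector_pos_scale d (a b : 'cV[R]_d) :
  b != 0 -> (forall u : 'rV[R]_d, 0 < (u *m a) 0 0 <-> 0 < (u *m b) 0 0) ->
  exists2 c, 0 < c & a = c *: b.
Proof.
move=> b0 ab.
have [j bj] : exists j, b j 0 != 0.
  apply/existsP; apply: contraR b0; rewrite negb_exists => /forallP bz.
  apply/eqP/colP => j; rewrite mxE; apply/eqP.
  by have := bz j; rewrite negbK.
pose u0 : 'rV[R]_d := (b j 0)^-1 *: delta_mx 0 j.
have u0b : (u0 *m b) 0 0 = 1.
  by rewrite /u0 -scalemxAl mxE -rowE mxE mulVf.
have c0 : 0 < (u0 *m a) 0 0 by apply/ab; rewrite u0b.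
exists ((u0 *m a) 0 0) => //.
have ker (v : 'rV[R]_d) : (v *m b) 0 0 = 0 -> (v *m a) 0 0 = 0.
  move=> vb; apply/eqP; rewrite eq_le !leNgt; apply/andP; split; apply/negP.
    by move/ab; rewrite vb ltxx.
  have -> : (v *m a) 0 0 < 0 = (0 < (- v *m a) 0 0) by rewrite mulNmx [(- (v *m a)) 0 0]mxE oppr_gt0.
  by move/ab; rewrite mulNmx [(- (v *m b)) 0 0]mxE vb oppr0 ltxx.
apply/colP => k.
have uE (e : 'cV[R]_d) :
    ((delta_mx 0 k - b k 0 *: u0) *m e) 0 0 = e k 0 - b k 0 * (u0 *m e) 0 0.
  by rewrite mulmxBl -scalemxAl -rowE !mxE.
have := ker (delta_mx 0 k - b k 0 *: u0).
rewrite !uE u0b mulr1 subrr => /(_ erefl)/eqP.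
by rewrite subr_eq0 => /eqP ->; rewrite [RHS]mxE mulrC.
Qed.

(** Near x one has a = phi b, where phi is the quotient of the entries of a and b
    at an index where b x does not vanish. Then g is the gradient of phi, and
    the correction term is the product of d phi and b. *)
Lemma ext_d1_scale d (a b : 'rV[R]_d -> 'cV[R]_d) x :
  (forall i k, derivable (fun y => a y k 0) x (delta_mx 0 i)) ->
  (forall i k, derivable (fun y => b y k 0) x (delta_mx 0 i)) ->
  (forall k, {for x, continuous (fun y => b y k 0)}) ->
  b x != 0 ->
  (\forall y \near x, forall u : 'rV[R]_d, 0 < (u *m a y) 0 0 <-> 0 < (u *m b y) 0 0) ->
  exists c g, [/\ 0 < c, a x = c *: b x &
    ext_d1 a x = c *: ext_d1 b x + (g *m (b x)^T - b x *m g^T)].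
Proof.
move=> da db cb bx ab.
have [c c0 axE] := covector_pos_scale bx (nbhs_singleton ab).
have [j bj] : exists j, b x j 0 != 0.
  apply/existsP; apply: contraR bx; rewrite negb_exists => /forallP bz.
  apply/eqP/colP => j; rewrite mxE; apply/eqP.
  by have := bz j; rewrite negbK.
pose phi y := a y j 0 * (b y j 0)^-1.
have dphi i : derivable phi x (delta_mx 0 i).
  apply: (@derivableM _ _ (fun y => a y j 0) (fun y => (b y j 0)^-1)) => //.
  exact: (@derivableV _ _ (fun y => b y j 0)).
have phix : phi x = c by rewrite /phi axE mxE mulfK.
have bjN0 : \forall y \near x, b y j 0 != 0.
  by apply: (cvgr_neq0 _ (cb j)); exact: bj.
have aE : \forall y \near x, a y = phi y *: b y.
  near=> y.
  have byj : b y j 0 != 0 by near: y.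
  have by0 : b y != 0.
    by apply: contraNneq byj => ->; rewrite mxE.
  have [|c' _ ayE] := @covector_pos_scale _ (a y) (b y) by0; first by near: y.
  rewrite {1}ayE; congr (_ *: _).
  by rewrite /phi ayE mxE mulfK.
pose g : 'cV[R]_d := \col_i pd i phi x.
exists c, g; split => //.
have pda i k : pd i (fun y => a y k 0) x = g i 0 * b x k 0 + c * pd i (fun y => b y k 0) x.
  rewrite (@pd_locally_eq _ _ i _ (fun y => \sum_(m < 1) phi y * b y k 0)); last first.
    by apply: filterS aE => y ->; rewrite big_ord1 mxE.
  by rewrite (@pd_sumM _ _ _ i (fun=> phi) (fun=> fun y => b y k 0)) // big_ord1 phix mxE.
apply/matrixP => i k.
rewrite !mxE !pda !big_ord1 !mxE; ring.
Unshelve. all: by end_near. Qed.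

(** The product of g and b dies after wedging with b. For lam > 0 the rest is a
    positive multiple of the hypothesis at tau = mu c / lam, and for lam = 0 a
    positive multiple of the top value of b and B. *)
Lemma wedge_pow_top_scale_pos d (a b : 'cV[R]_d.+1) (A B w : 'M[R]_d.+1) c g (lam mu : R) :
  ~~ odd d -> 0 < c -> a = c *: b -> A = c *: B + (g *m b^T - b *m g^T) ->
  0 <= lam -> 0 <= mu -> 0 < lam + mu ->
  0 < wedge_pow_top b B ->
  (forall tau, 0 <= tau -> 0 < wedge_pow_top b (w + tau *: B)) ->
  0 < wedge_pow_top a (lam *: w + mu *: A).
Proof.
move=> de c0 -> -> l0 m0 lm Bpos wpos.
rewrite wedge_pow_topZl pmulr_rgt0 //.
have -> : lam *: w + mu *: (c *: B + (g *m b^T - b *m g^T)) =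
    (lam *: w + (mu * c) *: B) + ((mu *: g) *m b^T - b *m (mu *: g)^T).
  rewrite scalerDr scalerA addrA; congr (_ + _).
  by rewrite scalerBr [(mu *: g)^T]linearZ /= -scalemxAl -scalemxAr.
rewrite wedge_pow_top_add_wedge //.
have [l_eq0|l_neq0] := eqVneq lam 0.
  have m_gt0 : 0 < mu by rewrite l_eq0 add0r in lm.
  rewrite l_eq0 scale0r add0r wedge_pow_topZr pmulr_rgt0 //.
  by rewrite exprn_gt0 // mulr_gt0.
have l_gt0 : 0 < lam by rewrite lt_def l_neq0.
have -> : lam *: w + (mu * c) *: B = lam *: (w + (mu * c / lam) *: B).
  by rewrite scalerDr scalerA mulrCA mulfV // mulr1.
rewrite wedge_pow_topZr pmulr_rgt0 ?exprn_gt0 //.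
by apply: wpos; rewrite divr_ge0 // mulr_ge0 // ltW.
Qed.

End Fibers.

(** * Products of topological spaces *)

Section ProductTopology.
Local Open Scope classical_set_scope.
Variables T U : topologicalType.

Lemma hausdorff_prod : hausdorff_space T -> hausdorff_space U ->
  hausdorff_space (T * U)%type.
Proof.
move=> hT hU [p1 p2] [q1 q2] pq; congr (_, _).
  apply: hT => A B pA qB.
  have [||z [[Az _] [Bz _]]] := pq (A `*` setT) (B `*` setT).
  - by exists (A, setT) => //=; split => //; exact: filterT.
  - by exists (B, setT) => //=; split => //; exact: filterT.
  - by exists z.1.
apply: hU => A B pA qB.
have [||z [[_ Az] [_ Bz]]] := pq (setT `*` A) (setT `*` B).
- by exists (setT, A) => //=; split => //; exact: filterT.
- by exists (setT, B) => //=; split => //; exact: filterT.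
- by exists z.2.
Qed.

Lemma open_setX (A : set T) (B : set U) : open A -> open B -> open (A `*` B).
Proof.
rewrite !openE => oA oB [x y] [/= /oA xA /oB yB].
by exists (A, B).
Qed.

Lemma second_countable_prod : @second_countable T -> @second_countable U ->
  @second_countable (T * U)%type.
Proof.
move=> [B cB [oB bB]] [C cC [oC bC]].
exists ((fun p => p.1 `*` p.2) @` (B `*` C)).
  by apply: sub_countable (card_image_le _ _) _; exact: countableX.
split=> [_ [[V W] [/= BV CW] <-]|[x y] A [[V W] [/= xV yW] VWA]].
  by apply: open_setX; [exact: oB|exact: oC].
have [V' [BV' V'x] V'V] := bB x V xV; have [W' [CW' W'y] W'W] := bC y W yW.
exists (V' `*` W'); first by split=> //; exists (V', W').
by move=> z [/V'V Vz /W'W Wz]; exact: VWA.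
Qed.

End ProductTopology.

(** * The torus as a closed oriented manifold *)

Section TorusManifold.
Import Order.TTheory GRing.Theory Num.Theory numFieldNormedType.Exports.
Local Open Scope classical_set_scope.
Local Open Scope ring_scope.
Variable R : realType.

Lemma continuous_addr_row d (y k : 'rV[R]_d) : {for y, continuous (fun z : 'rV[R]_d => z + k)}.
Proof.
apply: differentiable_continuous; apply: (@differentiableD _ _ _ id (cst k)).
  by [].
exact: differentiable_cst.
Qed.

Lemma continuous_coord_dist d (x : 'rV[R]_d) i c :
  {for x, continuous (fun y : 'rV[R]_d => `|y 0 i - c|)}.
Proof.
have /differentiable_continuous c1 := @smooth_open_coordD R d i (- c) [::] x I.
exact: cvg_norm c1.
Qed.

Local Notation proj x := (\pi_(torus_space R)%qT x).

Lemma torus_projE (x y : 'rV[R]_2) : proj x = proj y <-> lattice_rel x y.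
Proof. by split => [/(@eqmodP _ (lattice_equiv R))|xy] //; apply/(@eqmodP _ (lattice_equiv R)). Qed.

Lemma torus_proj_shift (x k : 'rV[R]_2) :
  (forall i, k 0 i \is a Num.int) -> proj (x + k) = proj x.
Proof.
by move=> kint; apply/torus_projE/forallP => i; rewrite mxE addrAC subrr add0r.
Qed.

Lemma torus_proj_continuous : continuous (fun x : 'rV[R]_2 => proj x).
Proof. exact: pi_continuous. Qed.

(** The saturation of U is the union of its translates by integer vectors. *)
Lemma torus_proj_open (U : set 'rV[R]_2) : open U -> open ((fun x => proj x) @` U).
Proof.
move=> oU; change (open ((fun x => proj x) @^-1` ((fun x => proj x) @` U))).
rewrite openE => y [u Uu uy].
have cs := @continuous_addr_row _ y (u - y).
have : \forall z \near y, U (z + (u - y)).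
  by apply: cs; rewrite addrCA subrr addr0; exact: nbhs_open.
apply: filterS => z Uz /=; exists (z + (u - y)) => //.
apply: torus_proj_shift => i; rewrite !mxE.
by move/torus_projE/forallP : uy; exact.
Qed.

Lemma torus_proj_surj (p : torus_space R) : exists x : 'rV[R]_2, proj x = p.
Proof. by exists (generic_quotient.repr p); rewrite reprK. Qed.

Lemma torus_box_inj (b x y : 'rV[R]_2) :
  torus_box b x -> torus_box b y -> proj x = proj y -> x = y.
Proof.
move=> bx by_ /torus_projE/forallP xy; apply/rowP => i; apply/eqP.
rewrite -subr_eq0; apply/negPn/negP => /(norm_intr_ge1 (xy i)).
rewrite leNgt => /negP; apply.
have -> : x 0 i - y 0 i = (x 0 i - b 0 i) - (y 0 i - b 0 i) by ring.
apply: le_lt_trans (ler_normB _ _) _.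
by have := bx i; have := by_ i; lra.
Qed.

Lemma torus_box_open (b : 'rV[R]_2) : open (torus_box b).
Proof.
rewrite openE => x bx.
apply: (@filter_forall _ _ (fun i (y : 'rV[R]_2) => `|y 0 i - b 0 i| < 2^-1) (nbhs x)) => i.
exact: (cvgr_lt _ (@continuous_coord_dist _ x i (b 0 i)) _ (bx i)).
Qed.

Lemma torus_coordE (b x : 'rV[R]_2) : torus_box b x -> coord (torus R) b (proj x) = x.
Proof.
move=> bx; apply: xget_unique => // y [by_ yx].
exact: (torus_box_inj (b := b)).
Qed.

Lemma torus_boxP (b : 'rV[R]_2) (p : torus R) : dom (torus R) b p ->
  torus_box b (coord (torus R) b p) /\ proj (coord (torus R) b p) = p.
Proof. by move=> [x bx <-]; rewrite torus_coordE. Qed.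

Lemma torus_cod (b : 'rV[R]_2) : @cod R 2 (torus R) b = torus_box b.
Proof.
apply/seteqP; split => [_ [p /torus_boxP[bp _] <-] //|x bx].
by exists (proj x); [exists x|exact: torus_coordE].
Qed.

(** Transitions are locally translations by integer vectors. *)
Lemma torus_transition (b b' x : 'rV[R]_2) : @overlap R 2 (torus R) b b' x ->
  exists k, \forall y \near x, @transition R 2 (torus R) b b' y = y + k.
Proof.
move=> [p [/torus_boxP[bp pp] [x' b'x' x'p]] px].
have x'x : lattice_rel x' x by apply/torus_projE; rewrite x'p -px.
exists (x' - x).
have cs := @continuous_addr_row _ x (x' - x).
have : \forall y \near x, torus_box b' (y + (x' - x)).
  by apply: cs; rewrite addrCA subrr addr0; apply: nbhs_open => //; exact: torus_box_open.
apply: filterS => y by_; rewrite /transition /=.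
rewrite -(torus_coordE by_); congr (coord (torus R) b' _).
apply/esym/torus_proj_shift => i; rewrite !mxE.
exact: (forallP x'x).
Qed.

Lemma torus_jac_transition (b b' x : 'rV[R]_2) : @overlap R 2 (torus R) b b' x ->
  jac (@transition R 2 (torus R) b b') x = 1%:M.
Proof.
move=> /torus_transition[k xk]; apply/matrixP => i j; rewrite !mxE.
rewrite (@pd_locally_eq _ _ i _ (fun y => y 0 j + k 0 j)) ?pd_coordD //.
by apply: filterS xk => y ->; rewrite mxE.
Qed.

Lemma torus_smooth_transition (b b' : 'rV[R]_2) :
  smooth_mx_on (@overlap R 2 (torus R) b b') (@transition R 2 (torus R) b b').
Proof.
move=> i j x /torus_transition[k xk].
exists (interior [set y | @transition R 2 (torus R) b b' y = y + k]).
exists (fun y => y 0 j + k 0 j); split => //.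
- exact: open_interior.
- by move=> s y _; exact: smooth_open_coordD.
- by move=> y /interior_subset /= -> _; rewrite (ord1 i) mxE.
Qed.

(** Subtracting the integer parts of the coordinates moves any point into the
    closed unit square. *)
Lemma torus_compact : compact [set: torus R].
Proof.
pose K := [set v : 'rV[R]_2 | forall i, `[0, 1]%classic (v ord0 i)].
have -> : [set: torus R] = (fun x => proj x) @` K.
  apply/seteqP; split => // p _; have [x xp] := torus_proj_surj p.
  exists (x + \row_i (- (Num.floor (x 0 i))%:~R)).
    move=> i; rewrite /= in_itv /= !mxE; apply/andP; split.
      by rewrite subr_ge0 floor_le.
    by have := floorD1_gt (x 0 i); rewrite intrD; lra.
  by rewrite torus_proj_shift // => i; rewrite mxE rpredN intr_int.
apply: continuous_compact.
  by apply: continuous_subspaceT; exact: torus_proj_continuous.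
by apply: (@rV_compact R 2 (fun=> `[0, 1]%classic)) => i; exact: segment_compact.
Qed.

Lemma dist_int_gt0 (r : R) : r \isn't a Num.int ->
  exists2 e, 0 < e & forall k, k \is a Num.int -> e <= `|r - k|.
Proof.
move=> rint; pose f := (Num.floor r)%:~R : R.
have f0 : f <= r by rewrite floor_le.
have f1 : r < f + 1 by have := floorD1_gt r; rewrite intrD.
have fr : f < r.
  rewrite lt_neqAle f0 andbT; apply: contraNneq rint => <-.
  exact: intr_int.
(* The distances to the two neighboring integers. *)
exists (Num.min (r - f) (f + 1 - r)); first by rewrite lt_min !subr_gt0 fr.
move=> _ /intrP[k ->]; have [kf|fk] := leP k (Num.floor r).
  have : k%:~R <= f by rewrite ler_int.
  by move=> ?; rewrite ge_min ger0_norm ?subr_ge0 ?lerD2l ?lerN2 ?(le_trans _ f0) //; apply/orP; left.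
have : f + 1 <= k%:~R by rewrite -(intrD _ _ 1) ler_int lezD1.
by move=> ?; rewrite ge_min ler0_norm; [apply/orP; right|]; lra.
Qed.

(** If the i-th coordinates of two lifts differ by a number at distance at least
    e from the integers, then strips of half-width e / 2 around the lifts have
    disjoint images. *)
Lemma torus_hausdorff : hausdorff_space (torus R).
Proof.
rewrite open_hausdorff => p q.
have [x <-] := torus_proj_surj p; have [y <-] := torus_proj_surj q => pq.
have : ~~ lattice_rel x y.
  by apply: contraNN pq => xy; apply/eqP/torus_projE.
rewrite negb_forall => /existsP[i] /dist_int_gt0[e e0 he].
pose N (z : 'rV[R]_2) := [set w : 'rV[R]_2 | `|w 0 i - z 0 i| < e / 2].
have oN z : open (N z).
  rewrite openE => w Nw.
  exact: (cvgr_lt _ (@continuous_coord_dist _ w i (z 0 i)) _ Nw).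
have Nz z : N z z by rewrite /N /= subrr normr0 divr_gt0.
exists ((fun x => proj x) @` N x, (fun x => proj x) @` N y) => /=.
  by split; apply/mem_set; [exists x|exists y].
split; [exact: torus_proj_open|exact: torus_proj_open|].
apply/eqP/seteqP; split => // r [[u Nu <-] [v Nv /torus_projE/forallP vu]].
have uv : u 0 i - v 0 i \is a Num.int by rewrite -opprB rpredN.
have := he _ uv; rewrite leNgt => /negP; apply.
have -> : x 0 i - y 0 i - (u 0 i - v 0 i) =
  (v 0 i - y 0 i) - (u 0 i - x 0 i) by ring.
by apply: le_lt_trans (ler_normB _ _) _; move: Nu Nv; rewrite /N /=; lra.
Qed.

(** The projection is open, so rational boxes project to a basis. *)
Lemma torus_second_countable : @second_countable (torus R).
Proof.
pose B (p : 'rV[rat]_2 * nat) :=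
  [set x : 'rV[R]_2 | forall i, `|x 0 i - ratr (p.1 0 i)| < (p.2.+1%:R)^-1].
have oB p : open (B p).
  rewrite openE => x Bx.
  apply: (@filter_forall _ _ (fun i (y : 'rV[R]_2) =>
    `|y 0 i - ratr (p.1 0 i)| < (p.2.+1%:R)^-1) (nbhs x)) => i.
  exact: (cvgr_lt _ (@continuous_coord_dist _ x i _) _ (Bx i)).
exists ((fun p => (fun x => proj x) @` B p) @` setT).
  by apply: sub_countable (card_image_le _ _) _; exact: countableP.
split => [_ [p _ <-]|p A pA]; first exact: torus_proj_open.
have [x xp] := torus_proj_surj p; subst p.
have /nbhs_ballP[r /= r0 xr] : nbhs x ((fun x => proj x) @^-1` A).
  exact: torus_proj_continuous pA.
have r20 : 0 < r / 2 by rewrite divr_gt0.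
have [n _ nr] := near_infty_natSinv_lt (PosNum r20).
have {}nr := nr n (leqnn n).
pose e : R := n.+1%:R^-1.
have e0 : 0 < e by rewrite invr_gt0.
have /choice[q qP] : forall i, exists q : rat, ratr q \in `]x 0 i - e, x 0 i + e[.
  by move=> i; apply: rat_in_itvoo; lra.
exists ((fun x => proj x) @` B (\row_i q i, n)).
  split; first by exists (\row_i q i, n).
  exists x => // i; rewrite /= mxE -/e ltr_norml.
  by have := qP i; rewrite in_itv /=; lra.
move=> _ [y By <-]; apply: xr; split=> // i j; rewrite (ord1 i).
have := By j; have := qP j; rewrite in_itv /= mxE -/e.
rewrite /ball /= ltr_norml => /andP[A1 A2] /andP[A3 A4].
by rewrite ltr_norml; apply/andP; split; move: nr; rewrite /= -/e; lra.
Qed.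

Lemma torus_manifold : manifold [set: 'rV[R]_2] (torus R).
Proof.
split.
- exact: torus_hausdorff.
- exact: torus_second_countable.
- move=> p; have [x <-] := torus_proj_surj p; exists x; exists x => // i.
  by rewrite subrr normr0 invr_gt0.
- move=> b; have odom : open (dom (torus R) b).
    by apply: torus_proj_open; exact: torus_box_open.
  split => //.
  + by exists (torus_box b); [exact: torus_box_open|rewrite torus_cod setTI].
  + by move=> p /torus_boxP[].
  + apply/subspace_continuousP => p bp; apply: cvg_within_filter.
    have [bx xp] := torus_boxP bp.
    move=> A xA; rewrite /nbhs /=.
    have xA' : interior A (coord (torus R) b p) by exact: xA.
    apply: (@filterS _ (nbhs p) _ ((fun x => proj x) @` (interior A `&` torus_box b))).
      move=> _ [y [Vy by_] <-]; change (A (coord (torus R) b (proj y))).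
      rewrite torus_coordE //.
      exact: interior_subset Vy.
    apply: open_nbhs_nbhs; split.
      by apply: torus_proj_open; apply: openI; [exact: open_interior|exact: torus_box_open].
    by exists (coord (torus R) b p).
  + by apply: continuous_subspaceT; exact: torus_proj_continuous.
- exact: torus_smooth_transition.
Qed.

Lemma torus_oriented : oriented (torus R).
Proof. by move=> b b' x /torus_jac_transition ->; rewrite det1. Qed.

End TorusManifold.

(** * Products of manifolds *)

Section ProductManifold.
Import Order.TTheory GRing.Theory Num.Theory numFieldNormedType.Exports.
Local Open Scope classical_set_scope.
Local Open Scope ring_scope.
Variable R : realType.

Section Charts.
Variables (d k : nat) (M : premanifold R d) (N : premanifold R k).

Lemma product_cod (c : chart (product M N)) :
  cod c = (lsubmx @^-1` cod c.1) `&` (rsubmx @^-1` cod c.2).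
Proof.
apply/seteqP; split => [_ [p [p1 p2] <-] | y [[p p1 py] [q q2 qy]]].
  by split => /=; rewrite ?row_mxKl ?row_mxKr; [exists p.1|exists p.2].
by exists (p, q) => //=; rewrite py qy hsubmxK.
Qed.

Lemma product_overlap (c c' : chart (product M N)) :
  overlap c c' = (lsubmx @^-1` overlap c.1 c'.1) `&` (rsubmx @^-1` overlap c.2 c'.2).
Proof.
apply/seteqP; split => [_ [p [[p1 p2] [q1 q2]] <-] | y [[p [p1 p1'] py] [q [q2 q2'] qy]]].
  by split => /=; rewrite ?row_mxKl ?row_mxKr; [exists p.1|exists p.2].
by exists (p, q) => //=; rewrite py qy hsubmxK.
Qed.

Lemma product_transition (c c' : chart (product M N)) y :
  transition c c' y =
  row_mx (transition c.1 c'.1 (lsubmx y)) (transition c.2 c'.2 (rsubmx y)).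
Proof. by []. Qed.

Lemma product_jac_transition (c c' : chart (product M N)) y :
  jac (transition c c') y = block_mx (jac (transition c.1 c'.1) (lsubmx y)) 0 0
    (jac (transition c.2 c'.2) (rsubmx y)).
Proof. exact: (@jac_row_mx _ _ _ _ _ (transition c.1 c'.1) (transition c.2 c'.2)). Qed.

Lemma product_oriented : oriented M -> oriented N -> oriented (product M N).
Proof.
move=> oM oN c c' y; rewrite product_overlap => -[y1 y2].
by rewrite product_jac_transition det_ublock mulr_gt0 ?oM ?oN.
Qed.

Lemma smooth_mx_on_row (d' k' : nat) (S : set 'rV[R]_d) (S' : set 'rV[R]_k)
  (F : 'rV[R]_d -> 'rV[R]_d') (G : 'rV[R]_k -> 'rV[R]_k') :
  smooth_mx_on S F -> smooth_mx_on S' G ->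
  smooth_mx_on ((lsubmx @^-1` S) `&` (rsubmx @^-1` S'))
    (fun y : 'rV[R]_(d + k) => row_mx (F (lsubmx y)) (G (rsubmx y))).
Proof.
move=> sF sG i j; rewrite (ord1 i); case: (split_ordP j) => j' ->.
  have -> : (fun y : 'rV[R]_(d + k) => row_mx (F (lsubmx y)) (G (rsubmx y)) 0 (lshift k' j')) =
      (fun y => F (lsubmx y) 0 j').
    by apply/funext => y; rewrite row_mxEl.
  by apply: smooth_on_subset (smooth_on_lsubmx (sF 0 j')) => y [].
have -> : (fun y : 'rV[R]_(d + k) => row_mx (F (lsubmx y)) (G (rsubmx y)) 0 (rshift d' j')) =
    (fun y => G (rsubmx y) 0 j').
  by apply/funext => y; rewrite row_mxEr.
by apply: smooth_on_subset (smooth_on_rsubmx (sG 0 j')) => y [].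
Qed.

Lemma cvg_row_mx (T : Type) (F : set_system T) (FF : Filter F)
  (u : T -> 'rV[R]_d) (v : T -> 'rV[R]_k) (x : 'rV[R]_d) (y : 'rV[R]_k) :
  u @ F --> x -> v @ F --> y -> (fun t => row_mx (u t) (v t)) @ F --> row_mx x y.
Proof.
move=> ux vy; apply: cvg_row => j; case: (split_ordP j) => j' ->.
  under eq_cvg => t do rewrite row_mxEl; rewrite row_mxEl.
  exact: (cvg_comp u (fun w : 'rV[R]_d => w 0 j') ux (@coord_continuous _ _ _ 0 j' x)).
under eq_cvg => t do rewrite row_mxEr; rewrite row_mxEr.
exact: (cvg_comp v (fun w : 'rV[R]_k => w 0 j') vy (@coord_continuous _ _ _ 0 j' y)).
Qed.

Lemma product_manifold (H : set 'rV[R]_d) :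
  manifold H M -> manifold [set: 'rV[R]_k] N ->
  manifold (lsubmx @^-1` H) (product M N).
Proof.
move=> [hM scM covM chM trM] [hN scN covN chN trN]; split.
- exact: hausdorff_prod.
- exact: second_countable_prod.
- move=> [p q]; have [c cp] := covM p; have [e qe] := covN q.
  by exists (c, e).
- move=> [c e]; have [oc [V oV cV] pc cc ccp] := chM c.
  have [oe [W oW eW] pe ce cep] := chN e; split.
  + exact: open_setX.
  + exists ((lsubmx @^-1` V) `&` (rsubmx @^-1` W)).
      apply: openI; first by move/continuousP: (@continuous_lsubmx R 1 d k); exact.
      by move/continuousP: (@continuous_rsubmx R 1 d k); exact.
    by rewrite product_cod /= cV eW setTI preimage_setI setIA.
  + by move=> [p q] [/= cp qe]; rewrite row_mxKl row_mxKr pc // pe.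
  + apply/subspace_continuousP => -[p q] [/= cp qe].
    apply: cvg_row_mx.
      move/subspace_continuousP : cc => /(_ p cp) cc.
      apply: (cvg_comp fst (coord M c) _ cc) => P pP.
      exists ([set x | dom M c x -> P x], setT) => /=.
        by split => //; exact: filterT.
      by move=> z [Pz _] [cz _]; exact: Pz.
    move/subspace_continuousP : ce => /(_ q qe) ce.
    apply: (cvg_comp snd (coord N e) _ ce) => P qP.
    exists (setT, [set x | dom N e x -> P x]) => /=.
      by split => //; exact: filterT.
    by move=> z [_ Pz] [_ ez]; exact: Pz.
  + rewrite product_cod; apply/subspace_continuousP => y [/= cy ey].
    apply: cvg_pair.
      move/subspace_continuousP : ccp => /(_ _ cy) ccp.
      apply: (cvg_comp lsubmx (param M c) _ ccp) => P yP.
      have nP := @continuous_lsubmx R 1 d k y _ yP.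
      by apply: (@filterS _ (nbhs y) (nbhs_filter y) _ _ _ nP) => z Pz [cz _]; exact: Pz.
    move/subspace_continuousP : cep => /(_ _ ey) cep.
    apply: (cvg_comp rsubmx (param N e) _ cep) => P yP.
    have nP := @continuous_rsubmx R 1 d k y _ yP.
    by apply: (@filterS _ (nbhs y) (nbhs_filter y) _ _ _ nP) => z Pz [_ ez]; exact: Pz.
- move=> c c'; rewrite product_overlap.
  exact: (smooth_mx_on_row (trM c.1 c'.1) (trN c.2 c'.2)).
Qed.

End Charts.
End ProductManifold.

(** * Independence of the filling condition of the charts *)

Section ChartChange.
Import Order.TTheory GRing.Theory Num.Theory numFieldNormedType.Exports.
Local Open Scope classical_set_scope.
Local Open Scope ring_scope.
Variable R : realType.

Lemma pull2_comp d k l (A : 'M[R]_(d, k)) (B : 'M[R]_(k, l)) w :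
  pull2 A (pull2 B w) = pull2 (A *m B) w.
Proof. by rewrite /pull2 trmx_mul !mulmxA. Qed.

Lemma pull2Z d k (A : 'M[R]_(d, k)) c w : pull2 A (c *: w) = c *: pull2 A w.
Proof. by rewrite /pull2 -scalemxAr -scalemxAl. Qed.

Lemma pull2D d k (A : 'M[R]_(d, k)) v w : pull2 A (v + w) = pull2 A v + pull2 A w.
Proof. by rewrite /pull2 mulmxDr mulmxDl. Qed.

Section Manifold.
Variables (d : nat) (H : set 'rV[R]_d) (M : premanifold R d).
Hypothesis mM : manifold H M.

Lemma manifold_paramK (c : chart M) p : dom M c p -> param M c (coord M c p) = p.
Proof. by move=> cp; have [_ _ _ /(_ c)[_ _ pc _ _] _] := mM; exact: pc. Qed.

Lemma manifold_dom_open (c : chart M) : open (dom M c).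
Proof. by have [_ _ _ /(_ c)[]] := mM. Qed.

Lemma manifold_cod_model (c : chart M) x : cod c x -> H x.
Proof.
by have [_ _ _ /(_ c)[_ [U oU cU] _ _ _] _] := mM; rewrite cU => -[].
Qed.

Lemma manifold_cod_nbhs (c : chart M) x : cod c x -> \forall y \near x, H y -> cod c y.
Proof.
have [_ _ _ /(_ c)[_ [U oU cU] _ _ _] _] := mM; rewrite cU => -[Hx Ux].
by apply: filterS (nbhs_open oU Ux) => y Uy Hy; split.
Qed.

Lemma manifold_param_nbhs (c : chart M) x (P : set M) : cod c x -> nbhs (param M c x) P ->
  \forall y \near x, cod c y -> P (param M c y).
Proof.
have [_ _ _ /(_ c)[_ _ _ _ pc] _] := mM => cx.
by move/subspace_continuousP : pc => /(_ x cx) pc /pc.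
Qed.

Lemma manifold_coord_nbhs (c : chart M) p (P : set 'rV[R]_d) : dom M c p ->
  nbhs (coord M c p) P -> \forall q \near p, dom M c q /\ P (coord M c q).
Proof.
have [_ _ _ /(_ c)[od _ _ cc _] _] := mM => cp.
move/subspace_continuousP : cc => /(_ p cp) cc /cc.
rewrite /nbhs /= => pP; have dp := open_nbhs_nbhs (conj od cp).
by apply: filterS2 dp pP => q cq Pq; split => //; exact: Pq.
Qed.

Lemma manifold_coord_cvg (c : chart M) p : dom M c p -> coord M c q @[q --> p] --> coord M c p.
Proof.
move=> cp P /(manifold_coord_nbhs cp).
by apply: filterS => q [].
Qed.

Lemma cod_coord (c : chart M) p : dom M c p -> cod c (coord M c p).
Proof. by move=> cp; exists p. Qed.

Lemma codP (c : chart M) x : cod c x -> dom M c (param M c x) /\ coord M c (param M c x) = x.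
Proof. by move=> [p cp <-]; rewrite manifold_paramK. Qed.

(** Overlaps are relatively open in the model space. *)
Lemma manifold_overlap_nbhs (c c' : chart M) x : overlap c c' x ->
  \forall y \near x, H y -> overlap c c' y.
Proof.
move=> [p [cp c'p] px].
have cx : cod c x by rewrite -px; exact: cod_coord.
have c'x : nbhs (param M c x) (dom M c').
  by rewrite -px manifold_paramK //; apply: open_nbhs_nbhs; split => //; exact: manifold_dom_open.
apply: filterS2 (manifold_cod_nbhs cx) (manifold_param_nbhs cx c'x) => y Hc cP Hy.
have cy := Hc Hy; have [yd yE] := codP cy.
by exists (param M c y) => //; split => //; exact: cP.
Qed.

End Manifold.

Lemma cod_open d (M : premanifold R d) c : manifold [set: 'rV[R]_d] M -> open (@cod R d M c).
Proof.
move=> mM; rewrite openE => x cx.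
by apply: filterS (manifold_cod_nbhs mM cx) => y; exact.
Qed.

Lemma overlap_open d (M : premanifold R d) (c c' : chart M) :
  manifold [set: 'rV[R]_d] M -> open (overlap c c').
Proof.
move=> mM; rewrite openE => x cx.
by apply: filterS (manifold_overlap_nbhs mM cx) => y; exact.
Qed.

Section Map.
Variables (d k : nat) (H : set 'rV[R]_k) (V : premanifold R d) (W : premanifold R k).
Hypotheses (mV : manifold [set: 'rV[R]_d] V) (mW : manifold H W).
Hypothesis Hray : forall x j (h : R), H x -> 0 <= h -> H (x + h *: delta_mx 0 j).
Variable i : V -> W.
Hypothesis ci : continuous i.
Hypothesis si : forall c c', smooth_mx_on (local_dom i c c') (local_rep i c c').

Lemma local_dom_open c c' : open (local_dom i c c').
Proof.
rewrite openE => x [p [cp c'p] px].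
have cx : cod c x by rewrite -px; exact: cod_coord.
have c'x : nbhs (param V c x) (i @^-1` dom W c').
  rewrite -px (manifold_paramK mV) //; apply: ci; apply: open_nbhs_nbhs.
  by split => //; exact: (manifold_dom_open mW).
have nx := nbhs_open (@cod_open _ V c mV) cx.
have np := manifold_param_nbhs mV cx c'x.
apply: (@filterS2 _ (nbhs x) _ _ _ _ _ nx np) => y cy cP.
have [yd yE] := codP mV cy.
by exists (param V c y) => //; split => //; exact: cP.
Qed.

Lemma local_rep_coord c c' p : dom V c p -> local_rep i c c' (coord V c p) = coord W c' (i p).
Proof. by move=> cp; rewrite /local_rep /= (manifold_paramK mV). Qed.

Lemma local_dom_coord c c' p : dom V c p -> dom W c' (i p) -> local_dom i c c' (coord V c p).
Proof. by move=> cp c'p; exists p. Qed.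

(** This makes the chain rule applicable to transitions of W at the boundary. *)
Lemma overlap_ray c c' x j : @overlap R k W c c' x ->
  \forall h \near (0 : R)^'+, overlap c c' (x + h *: delta_mx 0 j).
Proof.
move=> ox; have nx := near_right_ray (delta_mx 0 j) (manifold_overlap_nbhs mW ox).
have Hx : H x.
  by case: ox => p [cp _] <-; apply: (manifold_cod_model mW (c := c)); exact: cod_coord.
apply: filterS2 nx (nbhs_right_gt 0) => h hH h0; apply: hH.
by apply: Hray => //; exact: ltW.
Qed.

(** The representative of i from c to c0' factors both through the transition
    from c' to c0' and through the transition from c to c0. *)
Lemma pullback_chart_change (w : form2 W) c c0 c' c0' p :
  smooth_form2 w ->
  dom V c p -> dom V c0 p -> dom W c' (i p) -> dom W c0' (i p) ->
  pull2 (jac (local_rep i c c') (coord V c p)) (w c' (local_rep i c c' (coord V c p))) =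
  pull2 (jac (transition c c0) (coord V c p))
    (pull2 (jac (local_rep i c0 c0') (coord V c0 p))
           (w c0' (local_rep i c0 c0' (coord V c0 p)))).
Proof.
move=> [_ _ trw] cp c0p c'p c0'p.
set x := coord V c p; set x0 := coord V c0 p.
have Tx : transition c c0 x = x0 by rewrite /transition /= (manifold_paramK mV).
have ox : overlap c c0 x by exists p.
have ow : overlap c' c0' (coord W c' (i p)) by exists (i p).
rewrite !local_rep_coord // (trw _ _ _ ow) pull2_comp.
have -> : transition c' c0' (coord W c' (i p)) = coord W c0' (i p).
  by rewrite /transition /= (manifold_paramK mW).
rewrite pull2_comp; congr (pull2 _ _).
have ldx : local_dom i c c' x by exact: local_dom_coord.
have ldx0 : local_dom i c c0' x by exact: local_dom_coord.
have nd := nbhs_open (@local_dom_open c c') ldx.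
have nd0 := nbhs_open (@local_dom_open c c0') ldx0.
have E1 : jac (local_rep i c c0') x = jac (local_rep i c c') x *m
    jac (transition c' c0') (coord W c' (i p)).
  rewrite -(local_rep_coord c' cp) -(@jac_comp _ _ _ _ (local_dom i c c') (overlap c' c0')) //.
  - apply/matrixP => a b; rewrite !mxE; apply: pd_locally_eq.
    apply: filterS2 nd nd0 => y [q [cq c'q] qy] _; rewrite -qy !local_rep_coord //.
    by rewrite /transition /= (manifold_paramK mW).
  - apply: filterS2 nd nd0 => y [q [cq c'q] qy] [q' [cq' c0'q'] q'y].
    have qq' : q' = q by rewrite -(manifold_paramK mV cq') q'y -qy (manifold_paramK mV).
    by rewrite -qy local_rep_coord //; exists (i q) => //; split => //; rewrite -qq'.
  - by have [_ _ _ _] := mW; exact.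
  - by move=> j; rewrite local_rep_coord //; exact: overlap_ray.
rewrite -E1.
have ldx00 : local_dom i c0 c0' x0 by exact: local_dom_coord.
have nov := nbhs_open (@overlap_open _ V c c0 mV) ox.
have nS : \forall y \near x, local_dom i c0 c0' (transition c c0 y).
  apply: filterS2 nov nd0 => y [q [cq c0q] qy] [q' [cq' c0'q'] q'y].
  have qq' : q' = q by rewrite -(manifold_paramK mV cq') q'y -qy (manifold_paramK mV).
  rewrite -qy /transition /= (manifold_paramK mV) //; apply: local_dom_coord => //.
  by rewrite -qq'.
rewrite -Tx -(@jac_comp _ _ _ _ (overlap c c0) (local_dom i c0 c0')) //.
- apply/matrixP => a b; rewrite !mxE; apply: pd_locally_eq.
  apply: filterS nov => y [q [cq c0q] qy]; rewrite -qy.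
  rewrite /transition /= (manifold_paramK mV cq).
  by rewrite !local_rep_coord.
- by have [_ _ _ _] := mV; exact.
- move=> j; apply: near_right_ray; rewrite Tx.
  exact: nbhs_open (@local_dom_open c0 c0') ldx00.
Qed.

End Map.

Lemma ext_d1_chart_change d (V : premanifold R d) (a : form1 V) c c0 p :
  manifold [set: 'rV[R]_d] V -> smooth_form1 a -> dom V c p -> dom V c0 p ->
  a c (coord V c p) = jac (transition c c0) (coord V c p) *m a c0 (coord V c0 p) /\
  ext_d1 (a c) (coord V c p) =
  pull2 (jac (transition c c0) (coord V c p)) (ext_d1 (a c0) (coord V c0 p)).
Proof.
move=> mV [sa tra] cp c0p.
have ox : overlap c c0 (coord V c p) by exists p.
have Tx : transition c c0 (coord V c p) = coord V c0 p.
  by rewrite /transition /= (manifold_paramK mV).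
rewrite -Tx; split; first exact: tra.
apply: (@ext_d1_pullback _ _ _ (overlap c c0) (cod c0)) => //.
- exact: overlap_open.
- by have [_ _ _ _] := mV; exact.
- exact: cod_open.
- move=> y [q [cq c0q] <-]; rewrite /transition /= (manifold_paramK mV) //.
  exact: cod_coord.
- by move=> y; exact: tra.
Qed.

Lemma halfspace_ray d (x : 'rV[R]_d.+1) j (h : R) :
  halfspace x -> 0 <= h -> halfspace (x + h *: delta_mx 0 j).
Proof. by rewrite /halfspace /= !mxE => x0 h0; rewrite addr_ge0 // mulr_ge0. Qed.

Section FillingValue.
Variables (d : nat) (V : premanifold R d.+1) (W : premanifold R d.+2).
Hypotheses (mV : manifold [set: 'rV[R]_d.+1] V) (oV : oriented V).
Hypothesis mW : manifold (@halfspace R d.+1) W.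
Variable i : V -> W.
Hypothesis ci : continuous i.
Hypothesis si : forall c c', smooth_mx_on (local_dom i c c') (local_rep i c c').

(** The value of a /\ (lam w + mu da)^m on the coordinate frame, w being pulled
    back to V. Unlike the condition with parameter tau = mu / lam, it extends to
    tau = +oo, that is to lam = 0. *)
Definition filling_value (a : form1 V) (w : form2 W) c c' x (lam mu : R) : R :=
  wedge_pow_top (a c x) (lam *: pull2 (jac (local_rep i c c') x) (w c' (local_rep i c c' x))
    + mu *: ext_d1 (a c) x).

(** In the new frame the value is multiplied by the positive determinant of the
    transition. *)
Lemma filling_value_chart_change a w c c0 c' c0' p lam mu :
  ~~ odd d -> smooth_form1 a -> smooth_form2 w ->
  dom V c p -> dom V c0 p -> dom W c' (i p) -> dom W c0' (i p) ->
  0 < filling_value a w c0 c0' (coord V c0 p) lam mu ->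
  0 < filling_value a w c c' (coord V c p) lam mu.
Proof.
move=> de sa sw cp c0p c'p c0'p pos; rewrite /filling_value.
have [-> ->] := ext_d1_chart_change mV sa cp c0p.
rewrite (pullback_chart_change mV mW (@halfspace_ray _) ci si sw cp c0p c'p c0'p).
rewrite -pull2Z -[mu *: pull2 _ _]pull2Z -pull2D wedge_pow_top_congr //.
by apply: mulr_gt0 => //; apply: oV; exists p.
Qed.

End FillingValue.

End ChartChange.

(** * The symplectic product with the torus and its boundary *)

Section SumForm.
Import Order.TTheory GRing.Theory Num.Theory numFieldNormedType.Exports.
Local Open Scope classical_set_scope.
Local Open Scope ring_scope.
Variable R : realType.

Definition torus_area (s : R) : form2 (torus R) := fun _ _ => s *: area_mx R.

Lemma area_mx_trmx : (area_mx R)^T = - area_mx R.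
Proof. by rewrite /area_mx linearB /= !trmx_delta opprB. Qed.

Lemma torus_area_pull2 s (b b' : chart (torus R)) x : overlap b b' x ->
  pull2 (jac (transition b b') x) (s *: area_mx R) = s *: area_mx R.
Proof. by move=> /torus_jac_transition ->; rewrite /pull2 mul1mx trmx1 mulmx1. Qed.

Lemma torus_area_smooth s : smooth_form2 (torus_area s).
Proof.
split.
- by move=> c x _; rewrite /torus_area linearZ /= area_mx_trmx scalerN.
- by move=> c i j; exact: smooth_on_cst.
- by move=> b b' x ox; rewrite /torus_area torus_area_pull2.
Qed.

Lemma torus_area_form s : 0 < s -> area_form (torus_area s).
Proof.
move=> s0; split; first exact: torus_area_smooth.
by move=> c x _; rewrite /torus_area !mxE /= subr0 mulr1.
Qed.

Lemma det_area_mx s : \det (s *: area_mx R) = s ^+ 2.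
Proof.
rewrite detZ (expand_det_row _ 0) !big_ord_recl big_ord0 /cofactor !det_mx11 !mxE /=; ring.
Qed.

Section Product.
Variables (d : nat) (X : premanifold R d) (omega : form2 X).

Lemma pull2_block p q p' q' (J1 : 'M[R]_(p, p')) (J2 : 'M[R]_(q, q')) w1 w2 :
  pull2 (block_mx J1 0 0 J2) (block_mx w1 0 0 w2) =
  block_mx (pull2 J1 w1) 0 0 (pull2 J2 w2).
Proof.
rewrite /pull2 tr_block_mx !mulmx_block !trmx0.
by rewrite !mulmx0 !mul0mx !addr0 !add0r ?mulmx0 ?mul0mx.
Qed.

Lemma sum_form2_smooth s : smooth_form2 omega ->
  smooth_form2 (sum_form2 omega (torus_area s)).
Proof.
move=> [sk sm tr]; have [sk' sm' tr'] := torus_area_smooth s; split.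
- move=> c y; rewrite product_cod => -[y1 y2].
  by rewrite /sum_form2 tr_block_mx !trmx0 sk // sk' // opp_block_mx !oppr0.
- move=> c; rewrite product_cod => i j.
  case: (split_ordP i) => i' ->; case: (split_ordP j) => j' ->.
  + apply: (smooth_on_subset (S := lsubmx @^-1` cod c.1)); first by move=> y [].
    have := smooth_on_lsubmx (k := 2) (sm c.1 i' j'); congr smooth_on.
    by apply/funext => y; rewrite /sum_form2 block_mxEul.
  + have -> : (fun y => sum_form2 omega (torus_area s) c y (lshift 2 i') (rshift d j')) = (fun=> 0).
      by apply/funext => y; rewrite /sum_form2 block_mxEur mxE.
    exact: smooth_on_cst.
  + have -> : (fun y => sum_form2 omega (torus_area s) c y (rshift d i') (lshift 2 j')) = (fun=> 0).
      by apply/funext => y; rewrite /sum_form2 block_mxEdl mxE.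
    exact: smooth_on_cst.
  + have -> : (fun y => sum_form2 omega (torus_area s) c y (rshift d i') (rshift d j')) =
        (fun=> (s *: area_mx R) i' j').
      by apply/funext => y; rewrite /sum_form2 block_mxEdr.
    exact: smooth_on_cst.
- move=> c c' y; rewrite product_overlap => -[y1 y2].
  rewrite product_jac_transition product_transition /sum_form2 row_mxKl row_mxKr.
  rewrite pull2_block -tr; last exact: y1.
  by rewrite -tr'; last exact: y2.
Qed.

Lemma sum_form2_symplectic s : s != 0 -> symplectic omega ->
  symplectic (sum_form2 omega (torus_area s)).
Proof.
move=> s0 [sm cl]; split; first exact: sum_form2_smooth.
move=> c y; rewrite product_cod => -[/= y1 y2]; have [dw nw] := cl _ _ y1; split.
  pose f (j l : 'I_(d + 2)) := fun y => sum_form2 omega (torus_area s) c y j l.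
  have f11 j l : f (lshift 2 j) (lshift 2 l) = fun y => omega c.1 (lsubmx y) j l.
    by apply/funext => z; rewrite /f /sum_form2 block_mxEul.
  have f12 j l : f (lshift 2 j) (rshift d l) = fun=> 0.
    by apply/funext => z; rewrite /f /sum_form2 block_mxEur mxE.
  have f21 j l : f (rshift d j) (lshift 2 l) = fun=> 0.
    by apply/funext => z; rewrite /f /sum_form2 block_mxEdl mxE.
  have f22 j l : f (rshift d j) (rshift d l) = fun=> (s *: area_mx R) j l.
    by apply/funext => z; rewrite /f /sum_form2 block_mxEdr.
  have c0 i (r : R) : pd i (fun=> r) y = 0 by exact: pd_cst.
  have l0 i j l : pd (rshift d i) (fun y => omega c.1 (lsubmx y) j l) y = 0.
    exact: (pd_lsubmxr (fun z => omega c.1 z j l)).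
  move=> i j l; change (pd i (f j l) y + pd j (f l i) y + pd l (f i j) y = 0).
  case: (split_ordP i) => i' ->; case: (split_ordP j) => j' ->;
    case: (split_ordP l) => l' ->; rewrite ?f11 ?f12 ?f21 ?f22 ?c0 ?l0 ?addr0 //.
  have E a b b' := pd_lsubmxl (fun z => omega c.1 z b b') a y.
  by rewrite !E; exact: dw.
rewrite /sum_form2 unitmxE det_ublock det_area_mx unitrM -unitmxE nw /=.
by rewrite unitrX // unitfE.
Qed.

End Product.

Lemma sum_form2_orients d (X : premanifold R d.+1) (omega : form2 X) s :
  odd d -> 0 < s -> orients omega ->
  @orients R (d + 2) (product X (torus R)) (sum_form2 omega (torus_area s)).
Proof.
move=> dodd s0 ow c y cy.
have : @cod R (d.+1 + 2) (product X (torus R)) c y := cy.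
rewrite product_cod => -[/= y1 y2].
rewrite /sum_form2 /torus_area pow_top_area // mulr_gt0 //; last exact: ow.
by rewrite mulr_gt0 // ltr0n.
Qed.

(** The outward normal of X x T^2 is that of X, and the torus coordinates, which
    come last, contribute a block of their own. *)
Lemma det_boundary_prod m (J1 : 'M[R]_(m, m.+1)) (J2 : 'M[R]_2) :
  \det (col_mx (- delta_mx 0 0 : 'rV[R]_(m.+1 + 2)) (block_mx J1 0 0 J2) : 'M[R]_(m.+1 + 2)) =
  \det (col_mx (- delta_mx 0 0 : 'rV[R]_m.+1) J1 : 'M[R]_m.+1) * \det J2.
Proof.
rewrite -(@det_ublock _ _ _ _ 0); congr (\det _).
pose A : 'M[R]_(m.+1 + 2) :=
  col_mx (- delta_mx 0 0 : 'rV[R]_(m.+1 + 2)) (block_mx J1 0 0 J2).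
pose C : 'M[R]_m.+1 := col_mx (- delta_mx 0 0 : 'rV[R]_m.+1) J1.
change (A = block_mx C 0 0 J2).
have Au k j : A (lshift (m + 2) k : 'I_(1 + (m + 2))) j = - (delta_mx 0 0 : 'rV_(m.+1 + 2)) k j.
  transitivity ((- delta_mx 0 0 : 'rV[R]_(m.+1 + 2)) k j); last by rewrite mxE.
  exact: col_mxEu.
have Ad k j : A (rshift 1 k : 'I_(1 + (m + 2))) j = block_mx J1 0 0 J2 k j.
  exact: col_mxEd.
have Cu k j : C (lshift m k : 'I_(1 + m)) j = - (delta_mx 0 0 : 'rV_m.+1) k j.
  transitivity ((- delta_mx 0 0 : 'rV[R]_m.+1) k j); last by rewrite mxE.
  exact: col_mxEu.
have Cd k j : C (rshift 1 k : 'I_(1 + m)) j = J1 k j by exact: col_mxEd.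
have d00 : (0 : 'I_(m.+1 + 2)) = lshift 2 (0 : 'I_m.+1) by apply: val_inj.
apply/matrixP => i j.
case: (split_ordP (i : 'I_(m.+1 + 2))) => i' ->.
  case: (split_ordP (i' : 'I_(1 + m))) => i'' ->.
    have -> : lshift 2 (lshift m i'' : 'I_m.+1) = (lshift (m + 2) i'' : 'I_(m.+1 + 2)).
      exact: val_inj.
    rewrite Au; have <- : lshift 2 (lshift m i'' : 'I_m.+1) = (lshift (m + 2) i'' : 'I_(m.+1 + 2)).
      exact: val_inj.
    case: (split_ordP j) => j' ->.
      by rewrite block_mxEul Cu !mxE d00; congr (- (_ && _)%:R); exact: eq_lshift.
    rewrite block_mxEur !mxE d00 [X in _ && X](_ : _ = false).
      by rewrite andbF oppr0.
    by apply/eqP => /(congr1 val).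
  have E : lshift 2 (rshift 1 i'' : 'I_m.+1) = (rshift 1 (lshift 2 i'') : 'I_(m.+1 + 2)).
    exact: val_inj.
  rewrite [X in A X]E Ad; case: (split_ordP j) => j' ->.
    by rewrite !block_mxEul Cd.
  by rewrite !block_mxEur !mxE.
have E : rshift m.+1 i' = (rshift 1 (rshift m i') : 'I_(m.+1 + 2)) by exact: val_inj.
rewrite [X in A X]E Ad.
case: (split_ordP j) => j' ->; first by rewrite !block_mxEdl !mxE.
by rewrite !block_mxEdr.
Qed.

Section Boundary.
Variables (d : nat) (M : premanifold R d.+1) (X : premanifold R d.+2) (i : M -> X).

Local Notation V := (product M (torus R)).
Local Notation W := (product X (torus R)).
Local Notation I := (@prod_id R _ _ _ M X (torus R) i).

Lemma prod_id_local_dom (c : chart V) (c' : chart W) :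
  local_dom I c c' = (lsubmx @^-1` local_dom i c.1 c'.1) `&`
                     (rsubmx @^-1` overlap c.2 c'.2).
Proof.
apply/seteqP; split => [_ [p [[p1 p2] [q1 q2]] <-] | y [[p [p1 p1'] py] [q [q2 q2'] qy]]].
  by split => /=; rewrite ?row_mxKl ?row_mxKr; [exists p.1|exists p.2].
exists (p, q); first by [].
change (row_mx (coord M c.1 p) (coord (torus R) c.2 q) = y).
by rewrite py qy hsubmxK.
Qed.

Lemma prod_id_local_rep (c : chart V) (c' : chart W) y :
  local_rep I c c' y =
  row_mx (local_rep i c.1 c'.1 (lsubmx y)) (transition c.2 c'.2 (rsubmx y)).
Proof. by []. Qed.

Lemma prod_id_jac (c : chart V) (c' : chart W) y :
  jac (local_rep I c c') y = block_mx (jac (local_rep i c.1 c'.1) (lsubmx y)) 0 0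
    (jac (transition c.2 c'.2) (rsubmx y)).
Proof. exact: (@jac_row_mx _ _ _ _ _ (local_rep i c.1 c'.1) (transition c.2 c'.2)). Qed.

Lemma prod_id_pullback (omega : form2 X) s (c : chart V) (c' : chart W) y :
  local_dom I c c' y ->
  pull2 (jac (local_rep I c c') y)
    (sum_form2 omega (torus_area s) c' (local_rep I c c' y)) =
  block_mx (pull2 (jac (local_rep i c.1 c'.1) (lsubmx y))
                  (omega c'.1 (local_rep i c.1 c'.1 (lsubmx y)))) 0 0
    (s *: area_mx R).
Proof.
rewrite prod_id_local_dom => -[y1 y2]; rewrite prod_id_jac prod_id_local_rep.
rewrite /sum_form2 row_mxKl row_mxKr pull2_block /torus_area.
by rewrite (torus_area_pull2 s y2).
Qed.

Lemma prod_id_continuous : continuous i -> continuous I.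
Proof.
move=> ci [p q].
have c1 : (fun z : M * torus R => i z.1) @ (p, q) --> i p.
  exact: (cvg_comp fst i cvg_fst (ci p)).
have c2 : (fun z : M * torus R => z.2) @ (p, q) --> q by exact: cvg_snd.
exact: (cvg_pair c1 c2).
Qed.

Lemma prod_id_smooth :
  (forall c c', smooth_mx_on (local_dom i c c') (local_rep i c c')) ->
  forall c c', smooth_mx_on (local_dom I c c') (local_rep I c c').
Proof.
move=> si c c'; rewrite prod_id_local_dom.
exact: (smooth_mx_on_row (si c.1 c'.1) (@torus_smooth_transition R c.2 c'.2)).
Qed.

Lemma prod_id_oriented_boundary : oriented_boundary i ->
  @oriented_boundary R (d + 2) V W I.
Proof.
move=> [ci ii ri si]; split.
- exact: prod_id_continuous.
- by move=> [p q] [p' q'] [/ii -> ->].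
- have fst0 (x : 'rV[R]_d.+2) (y : 'rV[R]_2) :
      row_mx x y 0 (0 : 'I_(d.+2 + 2)) = x 0 0.
    by rewrite -(row_mxEl x y); congr (row_mx x y _ _); apply: val_inj.
  apply/seteqP; split => [_ [[p q] _ <-]|[p q] [[c b] [[/= cp bq] pq0]]].
    have : @bdry R d.+1 X (i p) by rewrite -ri; exists p.
    move=> [c [cp c0]]; have [b bq] : exists b, dom (torus R) b q.
      by have [_ _ cov _ _] := torus_manifold R; exact: cov.
    by exists (c, b); split => //; rewrite /= fst0.
  have : @bdry R d.+1 X p by exists c; split => //; rewrite -pq0 /= fst0.
  by rewrite -ri => -[p' _ <-]; exists (p', q).
- move=> c c'; split; first by apply: prod_id_smooth => e e'; have [] := si e e'.
  move=> y; rewrite prod_id_local_dom => -[y1 y2].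
  rewrite prod_id_jac (torus_jac_transition y2).
  have -> := det_boundary_prod (jac (local_rep i c.1 c'.1) (lsubmx (y : 'rV[R]_(d.+1 + 2)))) 1%:M.
  by rewrite det1 mulr1; have [_] := si c.1 c'.1; exact.
Qed.

End Boundary.

End SumForm.

(** * Choice of the area *)

Section UniformPositivity.
Import Order.TTheory GRing.Theory Num.Theory numFieldNormedType.Exports.
Local Open Scope classical_set_scope.
Local Open Scope ring_scope.
Variable R : realType.

Lemma mulmx_cvg (T : Type) (F : set_system T) (FF : Filter F) m n p
  (A : T -> 'M[R]_(m, n)) (B : T -> 'M[R]_(n, p)) (A0 : 'M[R]_(m, n)) (B0 : 'M[R]_(n, p)) :
  (forall i j, A t i j @[t --> F] --> A0 i j) ->
  (forall i j, B t i j @[t --> F] --> B0 i j) ->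
  forall i j, (A t *m B t) i j @[t --> F] --> (A0 *m B0) i j.
Proof.
move=> cA cB i j; rewrite mxE; under eq_cvg => t do rewrite mxE.
by apply: (cvg_big (@add_continuous R)) => k _; apply: cvgM.
Qed.

Lemma scale_add_cvg (T : Type) (F : set_system T) (FF : Filter F) m n
  (l k : T -> R) (A B : T -> 'M[R]_(m, n)) (l0 k0 : R) (A0 B0 : 'M[R]_(m, n)) :
  l @ F --> l0 -> k @ F --> k0 ->
  (forall i j, A t i j @[t --> F] --> A0 i j) ->
  (forall i j, B t i j @[t --> F] --> B0 i j) ->
  forall i j, (l t *: A t + k t *: B t) i j @[t --> F] --> (l0 *: A0 + k0 *: B0) i j.
Proof.
move=> cl ck cA cB i j.
have E (x y : R) (C D : 'M[R]_(m, n)) : (x *: C + y *: D) i j = x * C i j + y * D i j.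
  by rewrite !mxE.
by rewrite E; under eq_cvg => t do rewrite E; apply: cvgD; apply: cvgM.
Qed.

(** If l vanishes at z0, then P is already positive nearby. Otherwise l and Q are
    bounded below near z0, and the second term exceeds - P for large s. *)
Lemma dominated_pos (T : topologicalType) (P Q l : T -> R) (k : R) (z0 : T) :
  P @ z0 --> P z0 -> Q @ z0 --> Q z0 -> l @ z0 --> l z0 ->
  0 < k -> 0 < Q z0 -> 0 <= l z0 -> (l z0 = 0 -> 0 < P z0) ->
  \forall z \near z0 & s \near +oo, 0 <= l z -> 0 < P z + l z * s * k * Q z.
Proof.
move=> cP cQ cl k0 q0 l0 p0.
have nQ : \forall z \near z0, Q z0 / 2 < Q z.
  by apply: (cvgr_gt _ cQ); rewrite ltr_pdivrMr // ltr_pMr // ltr1n.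
have [lz|lz] := eqVneq (l z0) 0.
  have nP : \forall z \near z0, 0 < P z by apply: (cvgr_gt _ cP); exact: p0.
  exists ([set z | 0 < P z /\ Q z0 / 2 < Q z], [set s : R | 0 <= s]).
    by split => /=; [exact: filterI nP nQ|exact: nbhs_pinfty_ge].
  move=> [z s] [/= [Pz Qz] s0] lz0; rewrite ltr_wpDr // !mulr_ge0 // ?ltW //.
  by apply: lt_trans Qz; rewrite divr_gt0.
have {lz}lpos : 0 < l z0 by rewrite lt_def lz.
have nl : \forall z \near z0, l z0 / 2 < l z.
  by apply: (cvgr_gt _ cl); rewrite ltr_pdivrMr // ltr_pMr // ltr1n.
have nP : \forall z \near z0, P z0 - 1 < P z.
  by apply: (cvgr_gt _ cP); rewrite gtrBl ltr01.
pose m := l z0 / 2 * k * (Q z0 / 2).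
have m0 : 0 < m by rewrite !mulr_gt0 // invr_gt0.
exists ([set z | [/\ P z0 - 1 < P z, Q z0 / 2 < Q z & l z0 / 2 < l z]],
        [set s : R | (`|P z0| + 1) / m <= s]).
  split => /=; last by exists ((`|P z0| + 1) / m); split; [exact: num_real|move=> x /ltW].
  by apply: filterS3 nP nQ nl => z; exact: And3.
move=> [z s] [/= [Pz Qz lz] sm] _.
have s0 : 0 <= s by apply: le_trans sm; rewrite divr_ge0 ?addr_ge0 // ltW.
have ms : `|P z0| + 1 <= s * m by rewrite -ler_pdivrMr.
have mle : s * m <= l z * s * k * Q z.
  have -> : s * m = l z0 / 2 * s * k * (Q z0 / 2) by rewrite /m; ring.
  have l2 : 0 <= l z0 / 2 by rewrite divr_ge0.
  have q2 : 0 <= Q z0 / 2 by rewrite divr_ge0 // ltW.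
  have lsk : l z0 / 2 * s * k <= l z * s * k.
    by apply: ler_wpM2r; [exact: ltW|apply: ler_wpM2r => //; exact: ltW].
  by apply: ler_pM => //; [rewrite !mulr_ge0 // ltW|exact: ltW].
have := ler_norm (- P z0); rewrite normrN => Pn; lra.
Qed.

Section Fill.
Variables (d : nat) (M : premanifold R d.+1) (X : premanifold R d.+2) (i : M -> X).
Hypothesis de : ~~ odd d.
Hypotheses (mM : manifold [set: 'rV[R]_d.+1] M) (oM : oriented M) (kM : compact [set: M]).
Hypothesis mX : manifold (@halfspace R d.+1) X.
Hypothesis iB : oriented_boundary i.

Local Notation V := (product M (torus R)).
Local Notation W := (product X (torus R)).
Local Notation I := (@prod_id R _ _ _ M X (torus R) i).

Lemma product_torus_manifold : @manifold R (d + 2).+1 [set: 'rV[R]_(d + 2).+1] V.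
Proof. exact: (product_manifold mM (torus_manifold R)). Qed.

Lemma product_torus_boundary_manifold :
  @manifold R (d + 2).+2 (@halfspace R (d + 2).+1) W.
Proof.
have -> : @halfspace R (d + 2).+1 = lsubmx @^-1` (@halfspace R d.+1) :> set 'rV[R]_(d.+2 + 2).
  apply/funext => y; rewrite /halfspace /= mxE; congr (is_true (_ <= _)).
  by congr (y _ _); exact: val_inj.
exact: (product_manifold mX (torus_manifold R)).
Qed.

Variables (xi : hyperplane_field M) (eta : hyperplane_field V) (omega : form2 X).
Variables (a : form1 V) (a0 : form1 M).
Hypothesis res : restricts_to_fibers xi eta.
Hypothesis ca : @contact_form R (d + 2) V eta a.
Hypothesis ca0 : contact_form xi a0.
Hypothesis som : smooth_form2 omega.
Hypothesis fills0 : forall (tau : R) c c' x, 0 <= tau -> local_dom i c c' x ->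
  0 < wedge_pow_top (a0 c x)
    (pull2 (jac (local_rep i c c') x) (omega c' (local_rep i c c' x)) + tau *: ext_d1 (a0 c) x).

Definition omega_pull (c : chart M) (c' : chart X) (x : 'rV[R]_d.+1) : 'M[R]_d.+1 :=
  pull2 (jac (local_rep i c c') x) (omega c' (local_rep i c c' x)).

Lemma fiber_defining_form (c : chart V) y (u : 'rV[R]_d.+1) : cod c y ->
  0 < (u *m usubmx (a c y)) 0 0 <-> 0 < (u *m a0 c.1 (lsubmx y)) 0 0.
Proof.
move=> cy; have [_ [_ _ aP] _] := ca; have [_ [_ _ a0P] _] := ca0.
have -> : u *m usubmx (a c y) = row_mx u 0 *m a c y.
  by rewrite -[X in row_mx u 0 *m X]vsubmxK mul_row_col mul0mx addr0.
have cy1 : cod c.1 (lsubmx y) by move: cy; rewrite product_cod => -[].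
by rewrite -(aP _ _ _ cy) -(a0P _ _ _ cy1); exact: res.
Qed.

(** On a fiber, a is a positive multiple of a0, so this is the filling condition
    of omega, extended to lam = 0 by the contact condition of xi. *)
Lemma fiber_pos (c : chart V) (c' : chart X) y (lam mu : R) :
  cod c y -> local_dom i c.1 c' (lsubmx y) ->
  0 <= lam -> 0 <= mu -> 0 < lam + mu ->
  0 < wedge_pow_top (usubmx (a c y))
        (lam *: omega_pull c.1 c' (lsubmx y) + mu *: ulsubmx (ext_d1 (a c) y)).
Proof.
move=> cy ly l0 m0 lm.
have [_ [[sa _] _ _] _] := ca; have [_ [[sa0 _] a0N0 _] a0pos] := ca0.
have cy1 : cod c.1 (lsubmx y) by move: cy; rewrite product_cod => -[].
have n1 := nbhs_open (@cod_open _ _ M c.1 mM) cy1.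
have ny : nbhs y (cod c) := nbhs_open (@cod_open _ _ V c product_torus_manifold) cy.
have yE : row_mx (lsubmx y) (rsubmx y) = y by rewrite hsubmxK.
have [||||h [g [h0 aE dE]]] := @ext_d1_scale R _
    (fun z => usubmx (a c (row_mx z (rsubmx y)))) (a0 c.1) (lsubmx y) _ _ _ (a0N0 _ _ cy1).
- move=> e k.
  have -> : (fun z => usubmx (a c (row_mx z (rsubmx y))) k 0) =
      (fun z => a c (row_mx z (rsubmx y)) (lshift 2 k) 0).
    by apply/funext => z; rewrite mxE.
  apply: (@derivable_fiber _ _ _ (fun z => a c z (lshift 2 k) 0)); rewrite yE.
  exact: (@smooth_on_derivable R (d.+1 + 2) (cod c) (fun z => a c z (lshift 2 k) 0) y
    (delta_mx 0 (lshift 2 e)) ny (sa c (lshift 2 k) 0)).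
- move=> e k; exact: (@smooth_on_derivable R d.+1 (cod c.1) (fun z => a0 c.1 z k 0)
    (lsubmx y) (delta_mx 0 e) n1 (sa0 c.1 k 0)).
- move=> k.
  exact: (@smooth_on_cvg _ _ _ (nbhs (lsubmx y)) _ (cod c.1) _ id _ (sa0 c.1 k 0) cy1).
- apply: (@filterS _ (nbhs (lsubmx y)) _ _ _ _ n1) => z cz u.
  have cz' : cod c (row_mx z (rsubmx y)).
    by rewrite product_cod /= row_mxKl row_mxKr; split => //; move: cy; rewrite product_cod => -[].
  by have := fiber_defining_form u cz'; rewrite row_mxKl.
rewrite yE in aE.
have dE' : ulsubmx (ext_d1 (a c) y) = h *: ext_d1 (a0 c.1) (lsubmx y) +
    (g *m (a0 c.1 (lsubmx y))^T - a0 c.1 (lsubmx y) *m g^T).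
  by rewrite -dE -ext_d1_fiber yE.
apply: (wedge_pow_top_scale_pos de h0 aE dE' l0 m0 lm); first exact: a0pos.
by move=> tau t0; exact: fills0.
Qed.

(** The interpolated 2-form without the contribution of the area form. *)
Definition base_mx (c : chart V) (c' : chart X) (y : 'rV[R]_(d.+1 + 2)) (lam : R)
  : 'M[R]_(d.+1 + 2) :=
  lam *: block_mx (omega_pull c.1 c' (lsubmx y)) 0 0 0 + (1 - lam) *: ext_d1 (a c) y.

Lemma ulsubmx_base_mx c c' y lam : ulsubmx (base_mx c c' y lam) =
  lam *: omega_pull c.1 c' (lsubmx y) + (1 - lam) *: ulsubmx (ext_d1 (a c) y).
Proof.
rewrite /base_mx -[ext_d1 (a c) y in LHS]submxK !scale_block_mx add_block_mx.
by rewrite block_mxKul.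
Qed.

Lemma filling_value_area s (c : chart V) (c' : chart W) y lam :
  local_dom I c c' y ->
  @filling_value R (d + 2) V W I a (sum_form2 omega (torus_area s)) c c' y lam (1 - lam) =
  @wedge_pow_top R (d + 2) (a c y) (base_mx c c'.1 y lam) +
  lam * s * (d./2.+1)%:R *
  wedge_pow_top (usubmx (a c y)) (ulsubmx (base_mx c c'.1 y lam)).
Proof.
move=> ly; rewrite /filling_value prod_id_pullback //.
have -> : lam *: block_mx (omega_pull c.1 c'.1 (lsubmx y)) 0 0 (s *: area_mx R) +
    (1 - lam) *: ext_d1 (a c) y =
    base_mx c c'.1 y lam + block_mx 0 0 0 ((lam * s) *: area_mx R).
  rewrite /base_mx [RHS]addrAC; congr (_ + _).
  rewrite !scale_block_mx !scaler0 add_block_mx !addr0 add0r scalerA.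
  by [].
rewrite wedge_pow_top_area //; congr (_ + _ * wedge_pow_top _ _).
Qed.

Lemma omega_pull_cvg (T : Type) (F : set_system T) (FF : Filter F)
  (v : T -> 'rV[R]_d.+1) c c' x :
  local_dom i c c' x -> v @ F --> x ->
  forall e f, omega_pull c c' (v t) e f @[t --> F] --> omega_pull c c' x e f.
Proof.
move=> lx vx; have [ci _ _ si] := iB.
have sl := (si c c').1.
have olD : open (local_dom i c c') by exact: (local_dom_open mM mX ci).
have nD : \forall t \near F, local_dom i c c' (v t).
  by apply: vx; exact: nbhs_open.
have cJ e f : jac (local_rep i c c') (v t) e f @[t --> F] -->
    jac (local_rep i c c') x e f.
  rewrite mxE; under eq_cvg => t do rewrite mxE.
  exact: (smooth_on_cvg FF (smooth_on_pd e olD (sl 0 f)) lx vx nD).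
have cr : (fun t => local_rep i c c' (v t)) @ F --> local_rep i c c' x.
  by apply: (cvg_row FF) => j; exact: (smooth_on_cvg FF (sl 0 j) lx vx nD).
have lrc y : local_dom i c c' y -> cod c' (local_rep i c c' y).
  move=> [p [cp c'p] <-]; rewrite (local_rep_coord mM) //; exact: cod_coord.
have [_ sw _] := som.
have co e f : omega c' (local_rep i c c' (v t)) e f @[t --> F] -->
    omega c' (local_rep i c c' x) e f.
  apply: (smooth_on_cvg FF (sw c' e f) (lrc _ lx) cr).
  by apply: filterS nD => t; exact: lrc.
apply: mulmx_cvg; first by apply: mulmx_cvg; [exact: cJ|exact: co].
by move=> e f; rewrite mxE; under eq_cvg => t do rewrite mxE; exact: cJ.
Qed.

Section Limit.
Variables (T : Type) (F : set_system T) (FF : Filter F).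
Variables (y : T -> 'rV[R]_(d.+1 + 2)) (l : T -> R).
Variables (c : chart V) (c' : chart X) (y0 : 'rV[R]_(d.+1 + 2)) (l0 : R).
Hypotheses (yF : y @ F --> y0) (lF : l @ F --> l0).
Hypotheses (cy : cod c y0) (ly : local_dom i c.1 c' (lsubmx y0)).

Lemma near_cod : \forall t \near F, cod c (y t).
Proof.
apply: yF; exact: (nbhs_open (@cod_open _ _ V c product_torus_manifold) cy).
Qed.

Lemma base_mx_cvg e f : base_mx c c' (y t) (l t) e f @[t --> F] --> base_mx c c' y0 l0 e f.
Proof.
have [_ [[sa _] _ _] _] := ca.
apply: scale_add_cvg => //.
- by apply: cvgB => //; exact: cvg_cst.
- move=> {}e {}f; case: (split_ordP e) => e' ->; case: (split_ordP f) => f' ->.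
  + rewrite block_mxEul; under eq_cvg => t do rewrite block_mxEul.
    apply: omega_pull_cvg => //.
    exact: (cvg_comp y lsubmx yF (@continuous_lsubmx R 1 d.+1 2 y0)).
  + rewrite block_mxEur mxE; under eq_cvg => t do rewrite block_mxEur mxE.
    exact: cvg_cst.
  + rewrite block_mxEdl mxE; under eq_cvg => t do rewrite block_mxEdl mxE.
    exact: cvg_cst.
  + rewrite block_mxEdr mxE; under eq_cvg => t do rewrite block_mxEdr mxE.
    exact: cvg_cst.
- move=> {}e {}f; rewrite mxE; under eq_cvg => t do rewrite mxE.
  have oc := @cod_open _ _ V c product_torus_manifold.
  apply: cvgB.
    exact: (smooth_on_cvg FF (smooth_on_pd e oc (sa c f 0)) cy yF near_cod).
  exact: (smooth_on_cvg FF (smooth_on_pd f oc (sa c e 0)) cy yF near_cod).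
Qed.

Lemma form_cvg e : a c (y t) e 0 @[t --> F] --> a c y0 e 0.
Proof.
have [_ [[sa _] _ _] _] := ca.
exact: (smooth_on_cvg FF (sa c e 0) cy yF near_cod).
Qed.

Lemma total_cvg :
  @wedge_pow_top R (d + 2) (a c (y t)) (base_mx c c' (y t) (l t)) @[t --> F] -->
  @wedge_pow_top R (d + 2) (a c y0) (base_mx c c' y0 l0).
Proof.
by apply: wedge_pow_top_cvg; [exact: form_cvg|exact: base_mx_cvg].
Qed.

Lemma fiber_cvg :
  wedge_pow_top (usubmx (a c (y t))) (ulsubmx (base_mx c c' (y t) (l t))) @[t --> F] -->
  wedge_pow_top (usubmx (a c y0)) (ulsubmx (base_mx c c' y0 l0)).
Proof.
apply: wedge_pow_top_cvg.
  by move=> e; rewrite mxE; under eq_cvg => t do rewrite mxE; exact: form_cvg.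
move=> e f.
have E (A : 'M[R]_(d.+1 + 2)) : ulsubmx A e f = A (lshift 2 e) (lshift 2 f) by rewrite !mxE.
by rewrite E; under eq_cvg => t do rewrite E; exact: base_mx_cvg.
Qed.

End Limit.

(** In one fixed chart the two terms of the filling value are continuous in the
    point and in the interpolation parameter; the change of charts then gives
    all other charts. At parameter 0 the first term is the contact condition of
    eta. *)
Lemma filling_pos_locally (p : V) (l0 : R) : 0 <= l0 <= 1 ->
  \forall z \near (p, l0) & s \near +oo, 0 <= z.2 -> z.2 <= 1 ->
  forall (c : chart V) (c' : chart W), dom V c z.1 -> dom W c' (I z.1) ->
  0 < @filling_value R (d + 2) V W I a (sum_form2 omega (torus_area s)) c c'
        (coord V c z.1) z.2 (1 - z.2).
Proof.
move=> /andP[l00 l01]; have [ci _ _ si] := iB.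
have mV := product_torus_manifold; have mW := product_torus_boundary_manifold.
have [de2 [sa _ _] apos] := ca.
have oV : @oriented R (d + 2).+1 V := product_oriented oM (@torus_oriented R).
have cI := prod_id_continuous ci.
have sI := prod_id_smooth (fun c c' => (si c c').1).
have [_ _ /(_ p)[c0 c0p] _ _] := mV.
have [_ _ /(_ (I p))[c0' c0'p] _ _] := mW.
pose y (z : V * R) : 'rV[R]_(d.+1 + 2) := coord V c0 z.1.
have yF : y @ (p, l0) --> y (p, l0).
  exact: (cvg_comp fst (coord V c0) cvg_fst (manifold_coord_cvg mV c0p)).
have lF : snd @ (p, l0) --> l0 by exact: cvg_snd.
have cy : cod c0 (y (p, l0)) by exists p.
have ly : local_dom I c0 c0' (y (p, l0)) by exists p.
have ly1 : local_dom i c0.1 c0'.1 (lsubmx (y (p, l0))).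
  by move: ly; rewrite prod_id_local_dom => -[].
have cP := total_cvg (nbhs_filter _) yF lF cy ly1.
have cQ := fiber_cvg (nbhs_filter _) yF lF cy ly1.
have k0 : 0 < (d./2.+1)%:R :> R by rewrite ltr0n.
have Q0 : 0 < wedge_pow_top (usubmx (a c0 (y (p, l0))))
    (ulsubmx (base_mx c0 c0'.1 (y (p, l0)) l0)).
  rewrite ulsubmx_base_mx; apply: fiber_pos => //; first by rewrite subr_ge0.
  by rewrite addrC subrK ltr01.
have P0 : l0 = 0 ->
    0 < @wedge_pow_top R (d + 2) (a c0 (y (p, l0))) (base_mx c0 c0'.1 (y (p, l0)) l0).
  by move=> ->; rewrite /base_mx scale0r add0r subr0 scale1r; exact: apos.
have dom_near : \forall z \near (p, l0) & s \near (+oo : set_system R),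
    dom V c0 z.1 /\ dom W c0' (I z.1).
  exists ([set z : V * R | dom V c0 z.1 /\ dom W c0' (I z.1)], setT) => /=; last by move=> z [].
  split; last exact: filterT.
  apply: filterI.
    apply: (@cvg_fst _ _ (nbhs p) (nbhs l0) _ (dom V c0)).
    by apply: open_nbhs_nbhs; split => //; exact: (manifold_dom_open mV).
  apply: (@cvg_fst _ _ (nbhs p) (nbhs l0) _ (I @^-1` dom W c0')).
  apply: cI; apply: open_nbhs_nbhs; split => //; exact: (manifold_dom_open mW).
have := @dominated_pos _ _ _ snd _ (p, l0) cP cQ lF k0 Q0 l00 P0.
apply: filterS2 dom_near => -[z s] /= [c0z c0'z] pos z0 z1 c c' cz c'z.
have sw := sum_form2_smooth s som.
apply: (filling_value_chart_change mV oV mW cI sI de2 sa sw cz c0z c'z c0'z).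
rewrite filling_value_area; first exact: pos.
by exists z.1.
Qed.

(** By compactness of M x T^2 x [0, 1] the local bounds on s have a common
    one. *)
Lemma filling_pos_uniform : exists2 s : R, 0 < s &
  forall (p : V) (l : R) (c : chart V) (c' : chart W), 0 <= l <= 1 ->
  dom V c p -> dom W c' (I p) ->
  0 < @filling_value R (d + 2) V W I a (sum_form2 omega (torus_area s)) c c'
        (coord V c p) l (1 - l).
Proof.
have kK : compact ([set: V] `*` `[0, 1]%classic : set (V * R)).
  apply: compact_setX; last exact: segment_compact.
  by rewrite -setXTT; apply: compact_setX => //; exact: torus_compact.
have nK : \forall s \near (+oo : set_system R), ([set: V] `*` `[0, 1]%classic : set (V * R)) `<=`
  (fun z => 0 <= z.2 -> z.2 <= 1 ->
  forall (c : chart V) (c' : chart W), dom V c z.1 -> dom W c' (I z.1) ->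
  0 < @filling_value R (d + 2) V W I a (sum_form2 omega (torus_area s)) c c'
        (coord V c z.1) z.2 (1 - z.2)).
  apply: (compact_near_coveringP _).1 kK _ _ _ _ _ => -[p l0] [_ /=].
  by rewrite in_itv /= => l01; exact: filling_pos_locally.
have [s [s0 sP]] : exists s : R, 0 < s /\ _ := filter_ex (filterI (nbhs_pinfty_gt (num_real 0)) nK).
exists s => // p l c c' /andP[l0 l1] cp c'p.
apply: (sP (p, l)) => //; split => //=.
by rewrite in_itv /= l0.
Qed.

End Fill.
(** The condition at tau is, up to a positive factor, the filling value at
    lam = 1 / (1 + tau), for which 1 - lam = lam tau. *)
Theorem weakly_fills_product_torus d (M : premanifold R d.+1) (X : premanifold R d.+2)
  (xi : hyperplane_field M) (eta : hyperplane_field (product M (torus R)))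
  (a : form1 (product M (torus R))) (omega : form2 X) (i : M -> X) :
  ~~ odd d -> closed_oriented_manifold M -> restricts_to_fibers xi eta ->
  @contact_form R (d + 2) (product M (torus R)) eta a -> weakly_fills omega xi i ->
  exists2 s : R, 0 < s &
    @weakly_fills R (d + 2) (product X (torus R)) (sum_form2 omega (torus_area s))
      (product M (torus R)) eta (@prod_id R _ _ _ M X (torus R) i).
Proof.
move=> de [mM oM kM] res ca [[mX oX kX] so ow iB [a0 ca0 fills0]].
have som : smooth_form2 omega by case: so.
have [s s0 sP] := filling_pos_uniform de mM oM kM mX iB res ca ca0 som fills0.
exists s => //; split.
- split.
  + exact: product_torus_boundary_manifold mX.
  + exact: (product_oriented oX (@torus_oriented R)).
  + by rewrite -setXTT; apply: compact_setX => //; exact: torus_compact.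
- by apply: sum_form2_symplectic => //; rewrite gt_eqF.
- by apply: sum_form2_orients.
- exact: prod_id_oriented_boundary.
exists a => // tau c c' x t0 [p [cp c'p] <-].
have t1 : 0 < 1 + tau by rewrite ltr_pwDl.
pose l : R := (1 + tau)^-1.
have l0 : 0 < l by rewrite invr_gt0.
have l1 : l <= 1 by rewrite invf_le1 // lerDl.
have := sP p l c c' _ cp c'p; rewrite ltW // l1 => /(_ isT).
rewrite /filling_value; have -> : 1 - l = l * tau.
  by rewrite /l; field; exact: lt0r_neq0.
by rewrite -scalerA -scalerDr wedge_pow_topZr pmulr_rgt0 // exprn_gt0.
Qed.

End UniformPositivity.

Theorem proposition3 (R : realType) (n : nat)
  (M : premanifold R n.*2.+1) (xi : hyperplane_field M)
  (eta : hyperplane_field (product M (torus R)))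
  (X : premanifold R n.*2.+2) (omega : form2 X) (i : M -> X) :
  closed_oriented_manifold M ->
  contact_structure xi ->
  bourgeois xi eta ->
  weakly_fills omega xi i ->
  exists2 sigma : form2 (torus R), area_form sigma &
    @weakly_fills R (n.*2 + 2) (product X (torus R)) (sum_form2 omega sigma)
      (product M (torus R)) eta (@prod_id R _ _ _ M X (torus R) i).
Proof.
move=> cM _ [res [a ca _]] fills.
have de : ~~ odd n.*2 by rewrite odd_double.
have [s s0 fills_s] := weakly_fills_product_torus de cM res ca fills.
by exists (torus_area s); first exact: torus_area_form.
Qed.
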